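(* Let $d\ge2$ and $1\le k\le d-1$. There are constants $0<c'\le C'$, independent of $\lambda$, such that for every $\lambda>1$ for which $\lambda^2$ is an eigenvalue of $-\Delta$ on $\mathbb{T}^d$ there exist a totally geodesic submanifold $\Sigma\subset\mathbb{T}^d$ of dimension $k$ and a nonzero eigenfunction $e_\lambda$ on $\mathbb{T}^d$ (with $-\Delta e_\lambda=\lambda^2e_\lambda$) such that $$c'\sqrt{N_{d-k,\lambda}}\,\|e_\lambda\|_{L^2(\mathbb{T}^d)}\le\|e_\lambda\|_{L^2(\Sigma)}\le C'\sqrt{N_{d-k,\lambda}}\,\|e_\lambda\|_{L^2(\mathbb{T}^d)}.$$
   Context: $\mathbb{T}^d=\mathbb{R}^d/(2\pi\mathbb{Z})^d$ is the standard flat torus and $\Delta$ its Laplace-Beltrami operator. Eigenfunctions are complex valued; those with $-\Delta e_\lambda=\lambda^2e_\lambda$ are exactly the finite sums $e_\lambda(x)=\sum_{n\in\mathbb{Z}^d,\,|n|=\lambda}c_ne^{in\cdot x}$. Totally geodesic submanifolds are bounded and have unit Hausdorff measure: a totally geodesic submanifold $\Sigma\subset\mathbb{T}^d$ of dimension $k$ is the image in $\mathbb{T}^d$ of a relatively open subset $\tilde\Sigma$ of a $k$-dimensional affine plane in $\mathbb{R}^d$, with $k$-dimensional Hausdorff measure $1$, and contained in a ball of fixed radius $C_0$ (a fixed constant $C_0\ge d$). $L^2(\Sigma)$ is taken with respect to $k$-dimensional Hausdorff measure on $\tilde\Sigma$. For $j\ge1$, $\lambda S^j=\{x\in\mathbb{R}^{j+1}:|x|=\lambda\}$.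 Fix a constant $c_0>0$. For $\zeta\in S^j$, the $\lambda^{1/2}$-cap $C(\lambda\zeta,\lambda^{1/2})$ is the intersection of $\lambda S^j$ with the ball of radius $c_0\lambda^{1/2}$ centered at $\lambda\zeta$, and $$N_{j,\lambda}=\max_{\zeta\in S^j}\#\big(\mathbb{Z}^{j+1}\cap C(\lambda\zeta,\lambda^{1/2})\big).$$ Constants in the claim may depend on $d,k,c_0,C_0$. *)

(* Defs.v *)
From HB Require Import structures.
From mathcomp Require Import all_boot all_order all_algebra.
From mathcomp Require Import finmap.
From mathcomp Require Import all_classical all_reals all_analysis.
From mathcomp Require Import complex zify.

Set Implicit Arguments.
Unset Strict Implicit.
Unset Printing Implicit Defensive.

Import Order.TTheory GRing.Theory Num.Theory.
Import numFieldNormedType.Exports.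

Local Open Scope classical_set_scope.
Local Open Scope ring_scope.

(* The library norm `|x| on row vectors is the sup norm. *)
Definition enorm (R : realType) (n : nat) (x : 'rV[R]_n) : R :=
  Num.sqrt (\sum_i x ord0 i ^+ 2).

Definition eball (R : realType) (n : nat) (c : 'rV[R]_n) (r : R) :
    set 'rV[R]_n :=
  [set x | enorm (x - c) < r].

Definition ediam (R : realType) (n : nat) (A : set 'rV[R]_n) : \bar R :=
  ereal_sup [set (enorm (p.1 - p.2))%:E | p in A `*` A].

(* Volume of the unit ball of R^s, pi^(s/2) / Gamma(s/2 + 1), through the
   recursion omega_(s+2) = 2 pi / (s + 2) * omega_s. *)
Fixpoint unit_ball_volume (R : realType) (s : nat) : R :=
  match s with
  | 0 => 1
  | 1 => 2
  | s'.+2 => 2 * pi / s'.+2%:R * unit_ball_volume R s'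
  end.

Section hausdorff_measure.
Context {R : realType} {n : nat}.
Implicit Types (A : set 'rV[R]_n) (delta : R).
Variable s : nat.
Local Open Scope ereal_scope.

(* The test for set0 only matters when s = 0 (counting measure), where
   the power is 1. *)
Definition hausdorff_gauge A : \bar R :=
  if A == set0 then 0
  else (unit_ball_volume R s / 2 ^+ s)%:E * ediam A ^+ s.

Definition delta_cover delta A : set ((set 'rV[R]_n)^nat) :=
  [set U | (forall i, ediam (U i) <= delta%:E) /\ A `<=` \bigcup_i U i].

Definition hausdorff_delta delta A : \bar R :=
  ereal_inf [set \sum_(i <oo) hausdorff_gauge (U i) | U in delta_cover delta A].

(* With this normalization the s-dimensional measure is Lebesgue measure on
   each s-dimensional affine plane. *)
Definition hausdorff A : \bar R :=
  ereal_sup [set hausdorff_delta delta A | delta in [set delta | (0 < delta)%R]].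

Lemma unit_ball_volume_ge0 m : (0 <= unit_ball_volume R m)%R.
Proof.
suff: (0 <= unit_ball_volume R m)%R /\ (0 <= unit_ball_volume R m.+1)%R by case.
elim: m => [|m [IH1 IH2]]; first by [].
split => //.
change (0 <= 2 * pi / m.+2%:R * unit_ball_volume R m)%R.
by rewrite !mulr_ge0// ?pi_ge0// invr_ge0.
Qed.

Lemma ediam_ge0 A : A != set0 -> 0 <= ediam A.
Proof.
move=> /set0P[x Ax]; apply: (@le_trans _ _ (enorm (x - x))%:E).
  by rewrite lee_fin sqrtr_ge0.
by apply: ereal_sup_ubound; exists (x, x).
Qed.

Lemma hausdorff_gauge0 : hausdorff_gauge set0 = 0.
Proof. by rewrite /hausdorff_gauge eqxx. Qed.

Lemma hausdorff_gauge_ge0 A : 0 <= hausdorff_gauge A.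
Proof.
rewrite /hausdorff_gauge; case: ifPn => // A0.
rewrite mule_ge0//; last by rewrite expe_ge0// ediam_ge0.
by rewrite lee_fin divr_ge0// ?unit_ball_volume_ge0// exprn_ge0.
Qed.

Lemma hausdorff_delta_ge0 delta A : 0 <= hausdorff_delta delta A.
Proof.
apply: le_ereal_inf_tmp => _ [U _ <-].
by apply: nneseries_ge0 => i _ _; exact: hausdorff_gauge_ge0.
Qed.

Lemma hausdorff_ge0 A : 0 <= hausdorff A.
Proof.
apply: (@le_trans _ _ (hausdorff_delta 1 A)); first exact: hausdorff_delta_ge0.
by apply: ereal_sup_ubound; exists 1%R => //=.
Qed.

Lemma hausdorff0 : hausdorff set0 = 0.
Proof.
apply/eqP; rewrite eq_le hausdorff_ge0 andbT.
apply: ge_ereal_sup => _ [delta _ <-]; apply: ereal_inf_lbound.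
exists (fun=> set0); last by apply: eseries0 => i _ _; exact: hausdorff_gauge0.
split => [i|x//]; rewrite /ediam setX0 image_set0 ereal_sup0.
by rewrite leNye.
Qed.

Lemma le_hausdorff : {homo hausdorff : A B / A `<=` B >-> A <= B}.
Proof.
move=> A B AB; apply: ge_ereal_sup => _ [delta d0 <-].
apply: (@le_trans _ _ (hausdorff_delta delta B)); last first.
  by apply: ereal_sup_ubound; exists delta.
apply: ereal_inf_le_tmp => _ [U [Ud BU] <-]; exists U => //.
by split => //; exact: subset_trans BU.
Qed.

Lemma hausdorff_delta_sigma_subadditive delta :
  sigma_subadditive (hausdorff_delta delta).
Proof.
move=> A; have [[i ioo]|] := pselect (exists i, hausdorff_delta delta (A i) = +oo).
  rewrite (eseries_pinfty _ _ ioo) ?leey// => m _.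
  by rewrite -ltNye (lt_le_trans _ (hausdorff_delta_ge0 _ _)).
rewrite -forallNE => Aoo.
apply/lee_addgt0Pr => _/posnumP[e].
rewrite (le_trans _ (epsilon_trick _ _ _))//; last first.
  by move=> m; exact: hausdorff_delta_ge0.
pose P m (B : (set _)^nat) := delta_cover delta (A m) B /\
  \sum_(k <oo) hausdorff_gauge (B k)
    <= hausdorff_delta delta (A m) + (e%:num / (2 ^ m.+1)%:R)%:E.
have [G PG] : {G : ((set _)^nat)^nat & forall m, P m (G m)}.
  apply: (@choice _ _ P) => m; rewrite /P.
  have Sfin : hausdorff_delta delta (A m) \is a fin_num.
    by rewrite ge0_fin_numE ?hausdorff_delta_ge0// ltey; exact/eqP/Aoo.
  have en1 : (0 < e%:num / (2 ^ m.+1)%:R)%R by [].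
  have [_ [B mB <-] xS] := lb_ereal_inf_adherent en1 Sfin.
  by exists B; split => //; exact/ltW.
pose gg (x : nat * nat) := hausdorff_gauge (uncurry G x).
have gg0 x : 0 <= gg x by exact: hausdorff_gauge_ge0.
apply: (@le_trans _ _ (\esum_(i in setT) gg i)).
  apply: ereal_inf_lbound => /=.
  have /card_esym/ppcard_eqP[f] := card_nat2.
  exists (uncurry G \o f).
    split => [i|]; first by rewrite /=; case: (f i) => a b /=; exact: (PG a).1.1.
    move=> t [i _ /(PG i).1.2[j _ Gij]].
    by exists (f^-1%FUN (i, j)) => //=; rewrite invK ?inE.
  rewrite -(esum_pred_image gg _ xpredT) ?[fun=> _]set_true//.
  by rewrite image_eq.
rewrite (_ : esum _ _ = \sum_(i <oo) \sum_(j <oo) gg (i, j)).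
  apply: lee_lim.
  - apply: is_cvg_nneseries => i *.
    by apply: nneseries_ge0 => m *; exact: (gg0 (i, m)).
  - apply: is_cvg_nneseries => i *; apply: adde_ge0 => //.
    exact: hausdorff_delta_ge0.
  - by near=> m; apply: lee_sum => i _; exact: (PG i).2.
pose J : nat -> set (nat * nat) := fun i => [set (i, j) | j in setT].
rewrite (_ : setT = \bigcup_k J k); last first.
  by rewrite predeqE => -[a b]; split => // _; exists a => //; exists b.
rewrite esum_bigcupT //=; last first.
  apply/trivIsetP => i j _ _ ij.
  rewrite predeqE => -[m m'] /=; split => //= -[] [_] _ [<-{m} _].
  by move=> [m2 _] [] /esym/eqP; rewrite (negbTE ij).
rewrite -(image_id [set: nat]) -fun_true esum_pred_image//; last first.
  by move=> m _; exact: esum_ge0.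
apply: eq_eseriesr => /= j _.
rewrite -(esum_pred_image gg (pair j) predT)//=; last first.
  by move=> ? ? _ _; exact: (@can_inj _ _ _ snd).
by congr esum; rewrite predeqE => -[a b]; split; move=> [i _ <-]; exists i.
Unshelve. all: by end_near. Qed.

Lemma hausdorff_sigma_subadditive : sigma_subadditive hausdorff.
Proof.
move=> A; apply: ge_ereal_sup => _ [delta d0 <-].
apply: le_trans (hausdorff_delta_sigma_subadditive _ _) _.
apply: lee_nneseries => [i _ _|i _]; first exact: hausdorff_delta_ge0.
by apply: ereal_sup_ubound; exists delta.
Qed.

HB.instance Definition _ := isOuterMeasure.Build R 'rV[R]_n hausdorff
  hausdorff0 hausdorff_ge0 le_hausdorff hausdorff_sigma_subadditive.

End hausdorff_measure.

(* Restriction of the outer measure to its Caratheodory measurable sets (which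
   include the Borel sets). *)
Definition hausdorff_measure (R : realType) (n s : nat) :
    {measure set (caratheodory_type (@hausdorff R n s)) -> \bar R} :=
  let mu : {outer_measure set 'rV[R]_n -> \bar R} := hausdorff s in
  (mu : set (caratheodory_type mu) -> \bar R).

Definition L2norm (R : realType) (n s : nat) (A : set 'rV[R]_n)
    (u : 'rV[R]_n -> R[i]) : \bar R :=
  ('N[hausdorff_measure R n s]_2%:E
     [(fun x => (Normc.normc (u x))%:E) \_ A])%E.

(* Functions on T^d are functions on R^d invariant under (2 pi Z)^d. *)
Definition torus_periodic (R : realType) (d : nat) (u : 'rV[R]_d -> R[i]) :=
  forall (x : 'rV[R]_d) (m : 'rV[int]_d),
    u (x + (2 * pi) *: map_mx intr m) = u x.

Definition fundamental_domain (R : realType) (d : nat) : set 'rV[R]_d :=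
  [set x | forall i, 0 <= x ord0 i < 2 * pi].

(* The Riemannian volume of the flat torus T^d is its d-dimensional Hausdorff
   measure. *)
Definition torus_L2norm (R : realType) (d : nat) (u : 'rV[R]_d -> R[i]) :
    \bar R :=
  L2norm d (@fundamental_domain R d) u.

Definition partial (R : realType) (n : nat) (i : 'I_n) (g : 'rV[R]_n -> R) :
    'rV[R]_n -> R :=
  'D_(delta_mx ord0 i) g.

Definition is_C1 (R : realType) (n : nat) (g : 'rV[R]_n -> R) :=
  forall i, (forall x, derivable g x (delta_mx ord0 i)) /\
            continuous (partial i g).

Definition is_C2 (R : realType) (n : nat) (g : 'rV[R]_n -> R) :=
  is_C1 g /\ forall i, is_C1 (partial i g).

Definition laplacian (R : realType) (n : nat) (g : 'rV[R]_n -> R)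
    (x : 'rV[R]_n) : R :=
  \sum_i partial i (partial i g) x.

Definition claplacian (R : realType) (n : nat) (u : 'rV[R]_n -> R[i])
    (x : 'rV[R]_n) : R[i] :=
  Complex (laplacian (fun y => complex.Re (u y)) x)
          (laplacian (fun y => complex.Im (u y)) x).

(* Possibly zero; see is_torus_eigenvalue. *)
Definition torus_eigenfunction (R : realType) (d : nat) (mu : R)
    (u : 'rV[R]_d -> R[i]) :=
  [/\ torus_periodic u,
      is_C2 (fun x => complex.Re (u x)),
      is_C2 (fun x => complex.Im (u x)) &
      forall x, - claplacian u x = (mu%:C)%C * u x].

Definition is_torus_eigenvalue (R : realType) (d : nat) (mu : R) :=
  exists u : 'rV[R]_d -> R[i],
    torus_eigenfunction mu u /\ exists x, u x != 0.

Definition affine_plane (R : realType) (d : nat) (p : 'rV[R]_d)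
    (V : {vspace 'rV[R]_d}) : set 'rV[R]_d :=
  [set x | x - p \in V].

(* S is the lift to R^d of the submanifold of T^d. *)
Definition totally_geodesic (R : realType) (d k : nat) (C0 : R)
    (S : set 'rV[R]_d) :=
  exists (p : 'rV[R]_d) (V : {vspace 'rV[R]_d}) (O : set 'rV[R]_d)
         (c : 'rV[R]_d),
    [/\ \dim V = k,
        open O,
        S = affine_plane p V `&` O,
        hausdorff k S = 1%E &
        S `<=` eball c C0].

Definition unit_sphere (R : realType) (j : nat) : set 'rV[R]_j.+1 :=
  [set zeta | enorm zeta = 1].

Definition cap (R : realType) (j : nat) (c0 lam : R) (zeta : 'rV[R]_j.+1) :
    set 'rV[R]_j.+1 :=
  [set x | enorm x = lam] `&` eball (lam *: zeta) (c0 * Num.sqrt lam).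

Definition lattice_cap (R : realType) (j : nat) (c0 lam : R)
    (zeta : 'rV[R]_j.+1) : set 'rV[int]_j.+1 :=
  [set m | cap c0 lam zeta (map_mx intr m)].

Definition cap_count (R : realType) (j : nat) (c0 lam : R)
    (zeta : 'rV[R]_j.+1) : nat :=
  #|` fset_set (lattice_cap c0 lam zeta)|.

(* Written as a supremum; it is attained by cap_number_max. *)
Definition cap_number (R : realType) (j : nat) (c0 lam : R) : R :=
  sup [set (cap_count c0 lam zeta)%:R | zeta in @unit_sphere R j].

Lemma finite_lattice_sphere (R : realType) (j : nat) (lam : R) :
  finite_set [set m : 'rV[int]_j.+1 | enorm (map_mx intr m : 'rV[R]_j.+1) = lam].
Proof.
pose B := Num.bound lam.
pose f (v : {ffun 'I_j.+1 -> 'I_(B.*2.+1)}) : 'rV[int]_j.+1 :=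
  \row_i ((v i)%:Z - B%:Z).
apply: (@sub_finite_set _ _ (f @` setT)); last first.
  by apply: finite_image; exact: finite_finset.
move=> m /= mlam.
have le_m i : `|m ord0 i| <= B%:Z.
  have lam0 : 0 <= lam by rewrite -mlam sqrtr_ge0.
  have : `|(m ord0 i)%:~R : R| <= lam.
    rewrite -mlam /enorm -sqrtr_sqr ler_wsqrtr// (bigD1 i)//= mxE lerDl.
    by apply: sumr_ge0 => k _; exact: sqr_ge0.
  move=> /le_lt_trans/(_ (archi_boundP lam0)).
  by rewrite -/B -intr_norm -[B%:R]/((B%:Z)%:~R) ltr_int => /ltW.
have lt_m i : (absz (m ord0 i + B%:Z)%R < B.*2.+1)%N.
  have := le_m i; rewrite ler_norml => /andP[]; lia.
exists [ffun i => Ordinal (lt_m i)] => //.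
apply/rowP => i; rewrite mxE ffunE /= -[RHS]/(m ord0 i).
have := le_m i; rewrite ler_norml => /andP[]; lia.
Qed.

Lemma finite_lattice_cap (R : realType) (j : nat) (c0 lam : R)
  (zeta : 'rV[R]_j.+1) : finite_set (lattice_cap c0 lam zeta).
Proof.
by apply: sub_finite_set (finite_lattice_sphere j lam) => m [].
Qed.

Lemma cap_number_max (R : realType) (j : nat) (c0 lam : R) :
  (exists2 zeta, @unit_sphere R j zeta &
     cap_number j c0 lam = (cap_count c0 lam zeta)%:R) /\
  (forall zeta, @unit_sphere R j zeta ->
     (cap_count c0 lam zeta)%:R <= cap_number j c0 lam).
Proof.
pose M := #|` fset_set [set m : 'rV[int]_j.+1 |
                        enorm (map_mx intr m : 'rV[R]_j.+1) = lam]|.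
have leM (zeta : 'rV[R]_j.+1) : (cap_count c0 lam zeta <= M)%N.
  apply: fsubset_leq_card; rewrite -fset_set_sub.
  - by move=> m [].
  - exact: finite_lattice_cap.
  - exact: finite_lattice_sphere.
pose e1 : 'rV[R]_j.+1 := delta_mx ord0 ord0.
have Se1 : unit_sphere e1.
  rewrite /unit_sphere /= /enorm (bigD1 ord0)//= big1 => [|i i0].
    by rewrite mxE !eqxx addr0 expr1n sqrtr1.
  by rewrite mxE eqxx (negbTE i0) expr0n.
pose P n := `[< exists2 zeta, @unit_sphere R j zeta & cap_count c0 lam zeta = n >].
have exP : exists n, P n by exists (cap_count c0 lam e1); apply/asboolP; exists e1.
have leP n : P n -> (n <= M)%N by move=> /asboolP[z _ <-].
have [z Sz Nz] : exists2 zeta, @unit_sphere R j zeta &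
    cap_count c0 lam zeta = ex_maxn exP leP.
  by case: ex_maxnP => n /asboolP.
have ub : ubound [set (cap_count c0 lam zeta)%:R | zeta in @unit_sphere R j]
                 ((cap_count c0 lam z)%:R : R).
  move=> _ [w Sw <-]; rewrite ler_nat Nz; case: ex_maxnP => n _; apply.
  by apply/asboolP; exists w.
have eqz : cap_number j c0 lam = (cap_count c0 lam z)%:R.
  apply/eqP; rewrite eq_le; apply/andP; split.
    by apply: ge_sup => //; exists (cap_count c0 lam e1)%:R, e1.
  by apply: ub_le_sup; [exists (cap_count c0 lam z)%:R | exists z].
split; first by exists z.
by move=> w Sw; rewrite eqz; apply: ub; exists w.
Qed.

(* Main.v *)
(** The frequencies m of a fullest cap C(lam zeta, lam^(1/2)) satisfy
    0 <= lam - m.zeta < c0^2/2, because |m - lam zeta|^2 = 2 lam (lam - m.zeta).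
    Hence along the line spanned by zeta the exponentials e^{i m.x} of these N
    frequencies have phases that differ by O(1): their sum e has |e| <= N
    everywhere and |e| ~ N on a bounded portion of the k-plane spanned by zeta
    and k - 1 coordinate axes orthogonal to all the frequencies, whereas
    orthogonality gives |e|^2 ~ N on average over the torus.  If N = 0, then
    antisymmetrizing any eigenfunction with respect to a coordinate hyperplane
    gives one that vanishes on that hyperplane, and for some coordinate and
    some translate the result is not zero.

    Of the Hausdorff measures only scaling, translation invariance, positivity
    and finiteness on cubes, and measurability of half-spaces are used.  The
    normalized piece of plane is a cube of side 2 a with H^k = 1; comparing
    coverings of a cube with volume bounds a, and makes the piece fit in a
    ball of radius k. *)

Require Import Defs.
From mathcomp Require Import all_boot all_order all_algebra.
From mathcomp Require Import finmap.
From mathcomp Require Import all_classical all_reals all_analysis.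
From mathcomp Require Import measurable_realfun complex lra ring zify.

Set Implicit Arguments.
Unset Strict Implicit.
Unset Printing Implicit Defensive.

Import Order.TTheory GRing.Theory Num.Theory.
Import numFieldNormedType.Exports.

Local Open Scope classical_set_scope.
Local Open Scope ring_scope.

(** * Hausdorff measure and Lipschitz maps *)

Section gauge.
Context {R : realType} {n : nat}.
Implicit Types A B : set 'rV[R]_n.
Local Open Scope ereal_scope.

Lemma le_ediam A B : A `<=` B -> ediam A <= ediam B.
Proof.
move=> AB; apply: ereal_sup_le => _ [[x y] [/= Ax Ay] <-].
by exists (x, y) => //; split => /=; exact: AB.
Qed.

Lemma ediam_ubound A x y : A x -> A y -> (enorm (x - y))%:E <= ediam A.
Proof. by move=> Ax Ay; apply: ereal_sup_ubound; exists (x, y). Qed.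

Lemma lee_pexpe (x y : \bar R) (s : nat) : 0 <= x -> x <= y -> x ^+ s <= y ^+ s.
Proof.
move=> x0 xy; elim: s => [|s IH]; first by rewrite !expe0.
by rewrite !expeS lee_pmul ?expe_ge0.
Qed.

Lemma expeM (r : R) (x : \bar R) (s : nat) :
  (r%:E * x) ^+ s = (r ^+ s)%R%:E * x ^+ s.
Proof.
elim: s => [|s IH]; first by rewrite !expe0 expr0 mul1e.
by rewrite !expeS IH exprS EFinM muleACA.
Qed.

Lemma hausdorff_gaugeE s A : A != set0 ->
  hausdorff_gauge s A = (unit_ball_volume R s / 2 ^+ s)%:E * ediam A ^+ s.
Proof. by rewrite /hausdorff_gauge => /negbTE ->. Qed.

Lemma hausdorff_delta_anti s (A : set 'rV[R]_n) (delta delta' : R) :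
  (delta <= delta')%R -> hausdorff_delta s delta' A <= hausdorff_delta s delta A.
Proof.
move=> dd; apply: ereal_inf_le_tmp => _ [U [Ud AU] <-]; exists U => //.
by split => // i; rewrite (le_trans (Ud i))// lee_fin.
Qed.

Lemma hausdorff_delta_le s (A : set 'rV[R]_n) (delta : R) : (0 < delta)%R ->
  hausdorff_delta s delta A <= hausdorff s A.
Proof. by move=> d0; apply: ereal_sup_ubound; exists delta. Qed.

End gauge.

Lemma unit_ball_gauge_ge0 (R : realType) s : 0 <= unit_ball_volume R s / 2 ^+ s.
Proof. by rewrite divr_ge0// ?unit_ball_volume_ge0// exprn_ge0. Qed.

Section lipschitz.
Context {R : realType} {n m : nat}.
Local Open Scope ereal_scope.
Variables (A : set 'rV[R]_n) (f : 'rV[R]_n -> 'rV[R]_m) (r : R).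
Hypothesis r0 : (0 < r)%R.
Hypothesis fr : forall x y, A x -> A y -> (enorm (f x - f y) <= r * enorm (x - y))%R.

Let ediam_image (U : set 'rV[R]_n) : ediam (f @` (U `&` A)) <= r%:E * ediam U.
Proof.
apply: ge_ereal_sup => _ [[_ _] [/= [x [Ux Ax] <-] [y [Uy Ay] <-]] <-] /=.
apply: (@le_trans _ _ (r%:E * (enorm (x - y))%:E)).
  by rewrite -EFinM lee_fin fr.
by rewrite lee_pmul2l// ediam_ubound.
Qed.

Let gauge_image s (U : set 'rV[R]_n) :
  hausdorff_gauge s (f @` (U `&` A)) <= (r ^+ s)%R%:E * hausdorff_gauge s U.
Proof.
(* The gauge of the empty set is 0 even for [s = 0], so an empty image is treated apart. *)
have [->|fU0] := eqVneq (f @` (U `&` A)) set0.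
  rewrite hausdorff_gauge0 mule_ge0 ?hausdorff_gauge_ge0//.
  by rewrite lee_fin exprn_ge0// ltW.
have U0 : U != set0.
  by move/set0P : fU0 => [_ [x [Ux _] _]]; apply/set0P; exists x.
rewrite !hausdorff_gaugeE// muleCA lee_wpmul2l ?lee_fin ?unit_ball_gauge_ge0//.
by rewrite -expeM lee_pexpe ?ediam_ge0.
Qed.

(** The images of the traces on [A] of a [delta / r]-cover form a [delta]-cover of the image, and
    each gauge grows at most by the factor r^s. Taking traces first is what allows the Lipschitz
    bound to be assumed on [A] only. *)
Lemma hausdorff_lipschitz s : hausdorff s (f @` A) <= (r ^+ s)%R%:E * hausdorff s A.
Proof.
apply: ge_ereal_sup => _ [delta d0 <-].
apply: (@le_trans _ _ ((r ^+ s)%R%:E * hausdorff_delta s (delta / r)%R A)); last first.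
  have rs0 : 0 <= (r ^+ s)%R%:E by rewrite lee_fin exprn_ge0// ltW.
  by rewrite lee_wpmul2l// hausdorff_delta_le// divr_gt0.
rewrite -lee_pdivrMl ?exprn_gt0//; apply: le_ereal_inf_tmp => _ [U [Ud AU] <-].
rewrite lee_pdivrMl ?exprn_gt0// -nneseriesZl; last first.
  by move=> i _; exact: hausdorff_gauge_ge0.
apply: (@le_trans _ _ (\sum_(i <oo) hausdorff_gauge s (f @` (U i `&` A)))).
  apply: ereal_inf_lbound; exists (fun i => f @` (U i `&` A)) => //.
  split=> [i|_ [x Ax <-]].
    rewrite (le_trans (ediam_image _))// (@le_trans _ _ (r%:E * (delta / r)%:E))//.
      by rewrite lee_pmul2l// Ud.
    by rewrite -EFinM mulrC divfK ?gt_eqF.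
  by have [i _ Ui] := AU _ Ax; exists i => //; exists x.
apply: lee_nneseries => i _; last exact: gauge_image.
by move=> _; exact: hausdorff_gauge_ge0.
Qed.

End lipschitz.

(** * Measurability of half-spaces *)

Section enorm.
Context {R : realType} {n : nat}.
Implicit Types x y : 'rV[R]_n.

Lemma enorm_ge0 x : 0 <= enorm x.
Proof. exact: sqrtr_ge0. Qed.

Lemma sqr_enorm x : enorm x ^+ 2 = \sum_i x ord0 i ^+ 2.
Proof. by rewrite sqr_sqrtr// sumr_ge0// => i _; exact: sqr_ge0. Qed.

Lemma le_coord_enorm x i : `|x ord0 i| <= enorm x.
Proof.
rewrite /enorm -sqrtr_sqr ler_wsqrtr// (bigD1 i)//= lerDl.
by apply: sumr_ge0 => k _; exact: sqr_ge0.
Qed.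

Lemma enormZ (a : R) x : enorm (a *: x) = `|a| * enorm x.
Proof.
rewrite /enorm -sqrtr_sqr -sqrtrM ?sqr_ge0//; congr Num.sqrt.
by rewrite mulr_sumr; apply: eq_bigr => i _; rewrite mxE exprMn.
Qed.

Lemma le_enorm x (a : R) : (forall i, `|x ord0 i| <= a) ->
  enorm x <= Num.sqrt n%:R * `|a|.
Proof.
move=> xa; rewrite -(sqrtr_sqr a) -sqrtrM// ler_wsqrtr//.
rewrite -[n in n%:R]card_ord mulr_natl -sumr_const; apply: ler_sum => i _.
rewrite -(real_normK (num_real a)).
by rewrite -[X in X <= _]real_normK ?num_real// lerXn2r ?nnegrE// (le_trans (xa i)) ?ler_norm.
Qed.

End enorm.

Section measurability.
Context {R : realType} {n : nat}.
Variable s : nat.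
Implicit Types A B X : set 'rV[R]_n.
Local Open Scope ereal_scope.
Local Notation H := (@hausdorff R n s).

(** A covering set of diameter at most [delta] is too small to bridge the gap [b - a], so it meets
    only one of [A] and [B] and is charged once. *)
Lemma hausdorff_delta_separated (i : 'I_n) (a b delta : R) A B : (delta < b - a)%R ->
  (forall x, A x -> x ord0 i <= a)%R -> (forall x, B x -> b <= x ord0 i)%R ->
  hausdorff_delta s delta A + hausdorff_delta s delta B
    <= hausdorff_delta s delta (A `|` B).
Proof.
move=> dab Aa Bb; apply: le_ereal_inf_tmp => _ [U [Ud ABU] <-].
apply: (@le_trans _ _ (\sum_(j <oo) hausdorff_gauge s (U j `&` A) +
                       \sum_(j <oo) hausdorff_gauge s (U j `&` B))).
  apply: leeD; apply: ereal_inf_lbound.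
    exists (fun j => U j `&` A) => //; split=> [j|x Ax].
      by rewrite (le_trans (le_ediam (@subIsetl _ _ _))).
    by have [j _ Uj] := ABU x (or_introl Ax); exists j.
  exists (fun j => U j `&` B) => //; split=> [j|x Bx].
    by rewrite (le_trans (le_ediam (@subIsetl _ _ _))).
  by have [j _ Uj] := ABU x (or_intror Bx); exists j.
rewrite -nneseriesD; [|by move=> *; exact: hausdorff_gauge_ge0..].
apply: lee_nneseries => [j _ _|j _].
  by rewrite adde_ge0 ?hausdorff_gauge_ge0.
have le_gauge C : hausdorff_gauge s (U j `&` C) <= hausdorff_gauge s (U j).
  have [->|UC0] := eqVneq (U j `&` C) set0.
    by rewrite hausdorff_gauge0 hausdorff_gauge_ge0.
  have U0 : U j != set0.
    by move/set0P : UC0 => [x [Ux _]]; apply/set0P; exists x.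
  rewrite !hausdorff_gaugeE// lee_wpmul2l ?lee_fin ?unit_ball_gauge_ge0//.
  by rewrite lee_pexpe ?ediam_ge0 ?le_ediam.
have [->|/set0P[x [Ux Ax]]] := eqVneq (U j `&` A) set0.
  by rewrite hausdorff_gauge0 add0e.
have [->|/set0P[y [Uy By]]] := eqVneq (U j `&` B) set0.
  by rewrite hausdorff_gauge0 adde0.
exfalso; suff : (enorm (y - x) <= delta)%R.
  have := le_coord_enorm (y - x) i; rewrite !mxE => h1 h2.
  have := Aa _ Ax; have := Bb _ By; have := ler_norm (y ord0 i - x ord0 i).
  lra.
by rewrite -lee_fin (le_trans _ (Ud j))// ediam_ubound.
Qed.

Lemma hausdorff_separated (i : 'I_n) (a b : R) A B : (a < b)%R ->
  (forall x, A x -> x ord0 i <= a)%R -> (forall x, B x -> b <= x ord0 i)%R ->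
  H A + H B <= H (A `|` B).
Proof.
move=> ab Aa Bb.
have [->|ABoo] := eqVneq (H (A `|` B)) +oo; first exact: leey.
have fin C : C `<=` A `|` B -> H C \is a fin_num.
  move=> CAB; rewrite ge0_fin_numE ?hausdorff_ge0//.
  by rewrite (le_lt_trans (le_hausdorff _ CAB))// ltey.
have finA := fin _ (@subsetUl _ A B); have finB := fin _ (@subsetUr _ A B).
have fin_delta C (delta : R) : (0 < delta)%R -> H C \is a fin_num ->
    hausdorff_delta s delta C \is a fin_num.
  move=> d0; rewrite !ge0_fin_numE ?hausdorff_ge0 ?hausdorff_delta_ge0//.
  by apply: le_lt_trans; exact: hausdorff_delta_le.
rewrite -leeBrDr//; apply: ge_ereal_sup => _ [d1 d10 <-].
rewrite leeBrDr// -leeBrDl ?fin_delta//; apply: ge_ereal_sup => _ [d2 d20 <-].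
rewrite leeBrDl ?fin_delta//.
(* Below [d1] and [d2] for monotonicity in delta, and below the gap [b - a] for the separation. *)
pose d := Order.min (Order.min d1 d2) ((b - a) / 2)%R.
have d0 : (0 < d)%R by rewrite !lt_min d10 d20 divr_gt0// subr_gt0.
have dba : (d < b - a)%R.
  have : (d <= (b - a) / 2)%R by rewrite ge_min lexx orbT.
  by lra.
apply: le_trans (hausdorff_delta_le _ _ d0).
apply: le_trans (hausdorff_delta_separated dba Aa Bb).
by apply: leeD; apply: hausdorff_delta_anti; rewrite !ge_min lexx ?orbT.
Qed.

Lemma hausdorffU A B : H (A `|` B) <= H A + H B.
Proof. exact: outer_measureU2. Qed.

(* Caratheodory's criterion: cut X into the slices of heights a - 1/(m+1).
   Slices two apart are separated, so their measures telescope. *)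
Lemma caratheodory_halfspace (i : 'I_n) (a : R) :
  H.-caratheodory [set x : 'rV[R]_n | x ord0 i < a]%R.
Proof.
apply: (@le_caratheodory_measurable R _ H) => X.
set hs := [set x | _]; change (H (X `&` hs) + H (X `&` ~` hs) <= H X).
have [->|Xoo] := eqVneq (H X) +oo; first exact: leey.
have fin C : C `<=` X -> H C \is a fin_num.
  move=> CX; rewrite ge0_fin_numE ?hausdorff_ge0//.
  by rewrite (le_lt_trans (le_hausdorff _ CX))// ltey.
pose c (m : nat) : R := (a - m.+1%:R^-1)%R.
have c_lt m : (c m < c m.+1)%R.
  by rewrite /c ltrD2l ltrN2 ltf_pV2 ?posrE// ltr_nat.
have c_lta m : (c m < a)%R by rewrite /c ltrBlDr ltrDl invr_gt0.
have c_le m p : (m <= p)%N -> (c m <= c p)%R.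
  by move=> mp; rewrite /c lerD2l lerN2 lef_pV2 ?posrE// ler_nat.
pose P m := X `&` [set x : 'rV[R]_n | x ord0 i <= c m]%R.
pose D m := X `&` [set x : 'rV[R]_n | c m < x ord0 i <= c m.+1]%R.
have PX m : P m `<=` X by move=> x [].
have DX m : D m `<=` X by move=> x [].
pose g m := fine (H (P m)).
have gE m : H (P m) = (g m)%:E by rewrite fineK// fin.
have g_le m p : (m <= p)%N -> (g m <= g p)%R.
  move=> mp; rewrite -lee_fin -!gE; apply: le_hausdorff => x [Xx /= xm].
  by split=> //=; rewrite (le_trans xm)// c_le.
set Y := X `&` ~` _; set Z := X `&` _.
have YX : Y `<=` X by move=> x [].
have ZX : Z `<=` X by move=> x [].
(* The gap runs from [c m] to [a]. *)
have gY m : H (P m) + H Y <= H X.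
  apply: le_trans (le_hausdorff _ (_ : P m `|` Y `<=` X)); last by move=> x [/PX|/YX].
  apply: (@hausdorff_separated i (c m) a) => // [x []//|x [_ /= /negP]].
  by rewrite -leNgt.
(* The slab between [c m] and [c m.+1] is the gap; the slice [D m], adjacent to [P m], would leave
   none. *)
have gD m : H (P m) + H (D m.+1) <= H (P m.+2).
  apply: le_trans (le_hausdorff _ (_ : P m `|` D m.+1 `<=` P m.+2)); last first.
    move=> x [[Xx /= xm]|[Xx /= /andP[_ xm]]]; split => //=.
    by rewrite (le_trans xm)// c_le// ltnW.
  apply: (@hausdorff_separated i (c m) (c m.+1)) => // [x []//|x [_ /= /andP[/ltW]]//].
pose L := sup (range g).
have gub : has_ubound (range g).
  exists (fine (H X)) => _ [m _ <-]; rewrite -lee_fin -gE fineK ?fin//.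
  exact: le_hausdorff.
have gL m : (g m <= L)%R by apply: ub_le_sup => //; exists m.
(* Slices of even and of odd index telescope separately, whence the factor 2: together they
   contribute at most 2 L - g m - g (m+1), and [P m.+1] contributes g (m+1). *)
have ZL m : H Z <= (2 * L - g m)%R%:E.
  have ZU : Z `<=` P m.+1 `|` \bigcup_p D (m + p).+1.
    move=> x [Xx /= xa].
    have [xc|cx] := leP (x ord0 i) (c m.+1); [by left|right].
    have ex : exists p, (x ord0 i <= c (m + p).+2)%R.
      have e0 : (0 < a - x ord0 i)%R by rewrite subr_gt0.
      pose q := Num.truncn (a - x ord0 i)^-1%R; exists q.
      rewrite /c lerBrDl -lerBrDr -[leRHS]invrK lef_pV2 ?posrE ?invr_gt0//.
      apply: ltW; apply: (lt_le_trans (truncnS_gt _)).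
      by rewrite ler_nat -/q; lia.
    case: (ex_minnP ex) => p xp pmin; exists p => //; split => //=.
    rewrite xp andbT ltNge; apply/negP; case: p xp pmin => [|p] xp pmin xc.
      by move: xc; rewrite addn0 leNgt cx.
    by have := pmin p; rewrite -addnS => /(_ xc); rewrite ltnn.
  rewrite (le_trans (le_hausdorff _ ZU))// (le_trans (hausdorffU _ _))//.
  rewrite gE -leeBrDl//; apply: le_trans (hausdorff_sigma_subadditive _ _) _.
  have HD0 p : 0 <= H (D (m + p).+1) by exact: hausdorff_ge0.
  apply: lime_le; first by apply: is_cvg_nneseries => p _ _; exact: HD0.
  apply: nearW => N /=.
  have gD' p : H (D p.+1) <= (g p.+2 - g p)%R%:E.
    by rewrite EFinB leeBrDl// -(gE p) -(gE p.+2).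
  have : \sum_(0 <= p < N) H (D (m + p).+1) <=
         (g (m + N)%N + g (m + N)%N.+1 - g m - g m.+1)%:E.
    elim: N => [|N IH].
      by rewrite big_geq// addn0 lee_fin; lra.
    rewrite (big_nat_recr _ _ _ (leq0n N)).
    have := leeD IH (gD' (m + N)%N); rewrite -EFinD => /le_trans.
    by apply; rewrite lee_fin addnS; lra.
  move=> /le_trans; apply; rewrite -EFinB lee_fin.
  have := gL (m + N)%N; have := gL (m + N)%N.+1; lra.
(* In [ZL] the value [g m] can be taken arbitrarily close to its supremum [L]. *)
have ZL' : H Z <= L%:E.
  rewrite -(fineK (fin _ ZX)) lee_fin leNgt; apply/negP => LZ.
  have hsg : has_sup (range g) by split; first by exists (g 0%N), 0%N.
  have e0 : (0 < fine (H Z) - L)%R by rewrite subr_gt0.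
  have [_ [m _ <-] Lg] := sup_adherent e0 hsg.
  have := ZL m; rewrite -(fineK (fin _ ZX)) lee_fin => h; move: Lg; rewrite -/L.
  lra.
rewrite (le_trans (leeD2r _ ZL'))// -leeBrDr ?fin//.
rewrite -(fineK (fin X _))// -(fineK (fin Y _))// -EFinB lee_fin.
apply: ge_sup; first by exists (g 0%N), 0%N.
move=> _ [m _ <-]; rewrite lerBrDr -lee_fin EFinD.
by rewrite -gE !fineK ?fin.
Qed.

Lemma measurable_coord (i : 'I_n) :
  measurable_fun setT (fun x : caratheodory_type H => x ord0 i).
Proof.
apply: (measurability _ (RGenInftyO.measurableE R)) => //.
move=> _ [_ [a ->] <-]; rewrite setTI.
rewrite (_ : _ @^-1` _ = [set x : 'rV[R]_n | x ord0 i < a]%R).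
  exact: caratheodory_halfspace.
by apply/seteqP; split => x /=; rewrite in_itv.
Qed.

End measurability.

(** * Hausdorff measure of a cube *)

(* Induction on k, integrating in the last variable: this lower bound for the
   volume of a union of boxes needs no product measure. *)
Lemma cube_cover_volume (R : realType) (k : nat) (w r : nat -> R)
    (c : nat -> nat -> R) :
  (forall i, 0 <= w i) -> (forall i, 0 <= r i) ->
  (forall u : nat -> R, (forall j, -1 < u j < 1) ->
    (1 <= \sum_(i <oo)
       (w i * \prod_(j < k) \1_`[c i j - r i, c i j + r i] (u j))%:E)%E) ->
  ((2 ^+ k)%:E <= \sum_(i <oo) (w i * (2 * r i) ^+ k)%:E)%E.
Proof.
move=> w0 r0; elim: k w w0 => [|k IH] w w0 cover.
  have u0 (j : nat) : -1 < (0 : R) < 1 by rewrite ltrN10 ltr01.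
  rewrite expr0; apply: le_trans (cover (fun=> 0) u0) _.
  by apply: lee_nneseries => i _; rewrite big_ord0 ?lee_fin ?mulr1// expr0 mulr1.
pose I i : set (measurableTypeR R) := `[c i k - r i, c i k + r i]%classic.
(* Freezing coordinate [k] at [x] moves its indicator into the weight, which is why the statement
   carries weights. Points are sequences indexed by [nat], so lowering [k] does not change their
   type. *)
have slice x : -1 < x < 1 ->
    ((2 ^+ k)%:E <= \sum_(i <oo) (w i * (2 * r i) ^+ k)%:E * (\1_(I i) x)%:E)%E.
  move=> x1; under eq_eseriesr do rewrite -EFinM mulrAC.
  apply: IH => [i|u u1]; first by rewrite mulr_ge0.
  have u'1 j : -1 < (if j == k then x else u j) < 1 by case: eqP.
  apply: le_trans (cover _ u'1) _; apply: lee_nneseries => [i _ _|i _].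
    rewrite lee_fin mulr_ge0//; apply: prodr_ge0 => j _; by rewrite indicE.
  rewrite lee_fin big_ord_recr/= eqxx mulrA mulrAC -/(I i).
  rewrite (eq_bigr (fun j : 'I_k => \1_`[c i j - r i, c i j + r i] (u j)))//.
  by move=> j _; rewrite ltn_eqF.
pose D : set (measurableTypeR R) := `]-1, 1[%classic.
have mI i : measurable (I i) by exact: measurable_itv.
have mD : measurable D by exact: measurable_itv.
have muD : @lebesgue_measure R D = (2 : R)%:E.
  by rewrite lebesgue_measure_itv/= lte_fin ifT ?gtrN// -EFinB opprK.
have muI i : (lebesgue_measure (I i `&` D) <= (2 * r i)%:E)%E.
  apply: (@le_trans _ _ (lebesgue_measure (I i))).
    by apply: le_measure; [exact: mem_set (measurableI _ _ (mI i) mD)|exact: mem_set (mI i)|exact: subIsetl].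
  rewrite lebesgue_measure_itv/= lte_fin; case: ifPn => _.
    by rewrite -EFinB lee_fin; lra.
  by rewrite lee_fin mulr_ge0.
have wr0 i : 0 <= w i * (2 * r i) ^+ k.
  by rewrite mulr_ge0// exprn_ge0// mulr_ge0.
pose f i (x : measurableTypeR R) : \bar R :=
  ((w i * (2 * r i) ^+ k)%:E * (\1_(I i) x)%:E)%E.
have m1 i : measurable_fun D (fun x : measurableTypeR R => (\1_(I i) x : R)%:E).
  by apply/measurable_EFinP; exact: measurable_indic.
have mf i : measurable_fun D (f i) by exact: measurable_funeM.
have f0 i x : (0 <= f i x)%E by apply: mule_ge0; rewrite lee_fin ?indicE.
(* The slice bound is integrated over [x] in ]-1, 1[, an interval of length 2; each box contributes
   at most its side [2 * r i]. *)
have <- : (\int[@lebesgue_measure R]_(x in D) (2 ^+ k)%:E = (2 ^+ k.+1)%:E)%E.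
  rewrite integral_cst//; transitivity ((2 ^+ k)%:E * (2 : R)%:E)%E.
    by congr (_ * _)%E; exact: muD.
  by rewrite -EFinM exprSr.
apply: (@le_trans _ _ (\int[@lebesgue_measure R]_(x in D) \sum_(i <oo) f i x))%E.
  by apply: ge0_le_integral => //; exact: ge0_emeasurable_sum.
rewrite integral_nneseries//; apply: lee_nneseries => [i _ _|i _].
  exact: integral_ge0.
rewrite ge0_integralZl//; last by rewrite lee_fin.
rewrite integral_indic// exprSr mulrA [leRHS]EFinM; apply: lee_wpmul2l.
  by rewrite lee_fin.
exact: muI.
Qed.

Definition cube (R : realType) (k : nat) (a : R) : set 'rV[R]_k :=
  [set u | forall i, `|u ord0 i| < a].
Arguments cube {R} k a.

Section unit_cube.
Context {R : realType}.
Variable k : nat.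

(** A set of diameter r_i lies in the box of side 2 r_i around any of its points. Hence the sum of
    the (2 r_i)^k is at least the volume 2^k of the cube, so the sum of the r_i^k is at least 1.
    Covers with [delta = 1] suffice; the bound on [delta] serves only to make the diameters
    finite. *)
Lemma hausdorff_cube_ge :
  ((unit_ball_volume R k / 2 ^+ k)%:E <= hausdorff k (cube k (1 : R)))%E.
Proof.
apply: (@le_trans _ _ (hausdorff_delta k 1 (cube k (1 : R)))); last first.
  exact: hausdorff_delta_le.
apply: le_ereal_inf_tmp => _ [U [Ud QU] <-].
(* An empty member has [ediam] equal to -oo and contains no point: it gets weight 0, radius 0 and
   the default centre 0. *)
pose w i : R := (U i != set0)%:R.
pose p i : 'rV[R]_k := xget 0 (U i).
pose r i : R := if U i == set0 then 0 else fine (ediam (U i)).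
have diamE i : U i != set0 -> ediam (U i) = (r i)%:E.
  move=> Ui; rewrite /r (negbTE Ui) fineK// ge0_fin_numE ?ediam_ge0//.
  by rewrite (le_lt_trans (Ud i))// ltry.
have r0 i : 0 <= r i.
  have [Ui|Ui] := eqVneq (U i) set0; first by rewrite /r Ui eqxx.
  by rewrite -lee_fin -diamE// ediam_ge0.
have w0 i : 0 <= w i by [].
(* Coordinates extended by 0 to all indices in [nat], the form in which [cube_cover_volume] takes
   its centres. *)
pose coord i (u : 'rV[R]_k) := if insub i is Some j then u ord0 j else 0.
have coordE (j : 'I_k) u : coord j u = u ord0 j by rewrite /coord valK.
have : (((2 : R) ^+ k)%:E <= \sum_(i <oo) (w i * (2 * r i) ^+ k)%:E)%E.
  apply: (@cube_cover_volume _ _ w r (fun i j => coord j (p i))) => // u u1.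
  pose v : 'rV[R]_k := \row_j u j.
  have [i _ Uiv] : (\bigcup_i U i) v.
    by apply: QU => j; rewrite mxE ltr_norml u1.
  have Ui : U i != set0 by apply/set0P; exists v.
  have Upi : U i (p i) by apply: xgetPex; exists v.
  have t0 m : 0 <= w m * \prod_(j < k) \1_`[coord j (p m) - r m, coord j (p m) + r m] (u j).
    by rewrite mulr_ge0// prodr_ge0// => j _; rewrite indicE.
  apply: le_trans (nneseries_lim_ge i.+1 _); last by move=> m _ _; rewrite lee_fin.
  rewrite big_nat_recr//= -[leLHS]add0e leeD//.
    by rewrite sume_ge0// => m _; rewrite lee_fin.
  rewrite lee_fin /w Ui mul1r big1// => j _.
  rewrite indicE mem_set//= in_itv/= coordE.
  have : `|v ord0 j - p i ord0 j| <= r i.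
    have := le_coord_enorm (v - p i) j; rewrite !mxE => /le_trans; apply.
    by rewrite -lee_fin -diamE// ediam_ubound.
  by rewrite mxE ler_norml lerBrDl lerBlDl => /andP[? ?]; apply/andP; split; lra.
have -> : (\sum_(i <oo) (w i * (2 * r i) ^+ k)%:E =
    (2 ^+ k)%:E * \sum_(i <oo) (w i * r i ^+ k)%:E)%E.
  rewrite -nneseriesZl; last first.
    by move=> i _; rewrite lee_fin mulr_ge0// exprn_ge0.
  by apply: eq_eseriesr => i _; rewrite -EFinM exprMn mulrCA.
rewrite -[X in (X <= _ -> _)%E]mule1 lee_pmul2l ?lte_fin ?exprn_gt0// => h.
have -> : (\sum_(i <oo) hausdorff_gauge k (U i) =
    (unit_ball_volume R k / 2 ^+ k)%:E * \sum_(i <oo) (w i * r i ^+ k)%:E)%E.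
  rewrite -nneseriesZl; last first.
    by move=> i _; rewrite lee_fin mulr_ge0// exprn_ge0.
  apply: eq_eseriesr => i _; have [Ui|Ui] := eqVneq (U i) set0.
    by rewrite Ui hausdorff_gauge0 /w Ui eqxx mul0r mule0.
  by rewrite hausdorff_gaugeE// diamE// /w Ui mul1r EFin_expe.
by rewrite -[leLHS]mule1 lee_wpmul2l// lee_fin unit_ball_gauge_ge0.
Qed.

(** The M^k closed cells of side 2/M that subdivide the cube [-1, 1]^k, given by their centres. *)
Let cell (M : nat) (f : {ffun 'I_k -> 'I_M}) : set 'rV[R]_k :=
  [set u | forall j, `|u ord0 j - ((f j).*2.+1%:R / M%:R - 1)| <= M%:R^-1].

Let ediam_cell M f : (ediam (@cell M f) <= (Num.sqrt k%:R * (2 / M%:R))%:E)%E.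
Proof.
apply: ge_ereal_sup => _ [[x y] [/= fx fy] <-]; rewrite lee_fin.
rewrite -[2 / _]ger0_norm ?divr_ge0//; apply: le_enorm => j; rewrite !mxE.
have := fx j; have := fy j; rewrite !ler_norml => /andP[? ?] /andP[? ?].
by apply/andP; split; lra.
Qed.

Let cube_cell (M : nat) (u : 'rV[R]_k) : (0 < M)%N -> cube k 1 u ->
  exists f, @cell M f u.
Proof.
move=> M0 u1.
(* The affine image of the coordinate under (-1, 1) -> (0, M); its integer part is the index of the
   cell. *)
pose t j : R := (u ord0 j + 1) * M%:R / 2.
have MR : 0 < M%:R :> R by rewrite ltr0n.
have t0 j : 0 <= t j.
  have := u1 j; rewrite ltr_norml => /andP[? ?].
  by rewrite divr_ge0// mulr_ge0//; lra.
have tM j : (Num.truncn (t j) < M)%N.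
  rewrite -(ltr_nat R); apply: (@le_lt_trans _ _ (t j)).
    by have /andP[] := truncn_itv (t0 j).
  have := u1 j; rewrite ltr_norml => /andP[? ?].
  by rewrite /t ltr_pdivrMr// mulrC ltr_pM2l//; lra.
exists [ffun j => Ordinal (tM j)] => j; rewrite ffunE/=.
have /andP[] := truncn_itv (t0 j); set q := Num.Def.trunc _ => h1 h2.
have uE : u ord0 j = 2 * t j / M%:R - 1.
  by rewrite /t; field; rewrite gt_eqF.
have -> : u ord0 j - (q.*2.+1%:R / M%:R - 1) = (2 * (t j - q%:R) - 1) / M%:R.
  by rewrite uE -[q.*2.+1]addn1 -mul2n natrD natrM; field; rewrite gt_eqF.
rewrite normrM normfV (ger0_norm (ltW MR)) ler_pdivrMr// mulVf ?gt_eqF//.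
by move: h2; rewrite -[q.+1]addn1 natrD => h2; rewrite ler_norml; apply/andP; split; lra.
Qed.

(** There are M^k cells of diameter at most 2 sqrt(k) / M, so the powers of M cancel in the sum of
    their gauges, and the bound [C] does not depend on [delta]. *)
Lemma hausdorff_cube_fin : (hausdorff k (cube k (1 : R)) < +oo)%E.
Proof.
pose C : R := unit_ball_volume R k * Num.sqrt k%:R ^+ k.
apply: (@le_lt_trans _ _ C%:E); last exact: ltry.
apply: ge_ereal_sup => _ [delta d0 <-].
pose M := (Num.truncn (Num.sqrt k%:R * 2 / delta : R)).+1.
have MR : 0 < M%:R :> R by rewrite ltr0n.
have Md : Num.sqrt k%:R * (2 / M%:R) <= delta :> R.
  by rewrite mulrA ler_pdivrMr// [leRHS]mulrC -ler_pdivrMr// ltW// truncnS_gt.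
pose e := enum {ffun 'I_k -> 'I_M}.
pose f0 : {ffun 'I_k -> 'I_M} := [ffun=> ord0].
(* The finite family of cells, padded to a sequence by empty sets of gauge 0. *)
pose U i := if (i < size e)%N then cell (nth f0 e i) else set0.
apply: (@le_trans _ _ (\sum_(i <oo) hausdorff_gauge k (U i))%E).
  apply: ereal_inf_lbound; exists U => //; split => [i|u u1].
    rewrite /U; case: ifP => _; last first.
      by rewrite /ediam setX0 image_set0 ereal_sup0 leNye.
    by rewrite (le_trans (ediam_cell _))// lee_fin.
  have [f fu] := @cube_cell M u isT u1; exists (index f e) => //.
  by rewrite /U index_mem mem_enum nth_index// mem_enum.
rewrite (nneseries_split 0 (size e)); last first.
  by move=> i _; exact: hausdorff_gauge_ge0.
rewrite add0n eseries0 ?adde0; last first.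
  by move=> i ei _; rewrite /U ltnNge ei/= hausdorff_gauge0.
pose g := (unit_ball_volume R k / 2 ^+ k) * (Num.sqrt k%:R * (2 / M%:R)) ^+ k.
have g0 : 0 <= g.
  apply: mulr_ge0; first exact: unit_ball_gauge_ge0.
  by apply/exprn_ge0/mulr_ge0; [exact: sqrtr_ge0|rewrite divr_ge0].
apply: (@le_trans _ _ (\sum_(0 <= i < size e) g%:E)%E).
  apply: lee_sum => i _; rewrite /U.
  have [|/set0P[u Uu]] := eqVneq (if (i < size e)%N then cell (nth f0 e i) else set0) set0.
    by move=> ->; rewrite hausdorff_gauge0 lee_fin.
  have U0 : (if (i < size e)%N then cell (nth f0 e i) else set0) != set0.
    by apply/set0P; exists u.
  rewrite hausdorff_gaugeE// /g [leRHS]EFinM lee_wpmul2l ?lee_fin ?unit_ball_gauge_ge0//.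
  rewrite EFin_expe lee_pexpe ?ediam_ge0//.
  by move: Uu {U0}; case: ifP => // _ _; exact: ediam_cell.
rewrite sumEFin lee_fin sumr_const_nat subn0 -cardE card_ffun !card_ord.
rewrite -mulr_natr natrX /g /C !exprMn exprVn.
rewrite le_eqVlt; apply/orP; left; apply/eqP.
by field; rewrite !expf_neq0 ?gt_eqF.
Qed.

End unit_cube.

(** * Cubes in a plane *)

(** The square of a volume comparison: the ball of radius sqrt(k) contains the cube [-1, 1]^k. The
    induction follows the two-step recursion of the volume, and its step comes down to 4 pi^2 >=
    16. *)
Lemma unit_ball_volume_sqr (R : realType) (k : nat) :
  4 ^+ k <= unit_ball_volume R k ^+ 2 * k%:R ^+ k.
Proof.
suff: 4 ^+ k <= unit_ball_volume R k ^+ 2 * k%:R ^+ k /\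
      4 ^+ k.+1 <= unit_ball_volume R k.+1 ^+ 2 * k.+1%:R ^+ k.+1 by case.
elim: k => [|k [IH1 IH2]]; first by rewrite !expr0 /= !expr1n; split; lra.
split => //.
have -> : unit_ball_volume R k.+2 ^+ 2 * k.+2%:R ^+ k.+2 =
    4 * pi ^+ 2 * (unit_ball_volume R k ^+ 2 * k.+2%:R ^+ k).
  have : k.+2%:R != 0 :> R by rewrite pnatr_eq0.
  rewrite [unit_ball_volume R k.+2]/= !exprS.
  by move: (k.+2%:R) (unit_ball_volume R k) => c v c0; field.
rewrite 2!exprS mulrA ler_pM ?exprn_ge0//.
  have := pi_ge2 R => h; rewrite -[4]/(4%:R) -natrM; nra.
apply: le_trans IH1 _; rewrite ler_wpM2l ?sqr_ge0// lerXn2r ?nnegrE//.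
by rewrite ler_nat; lia.
Qed.

Section isometry.
Context {R : realType} {n m : nat}.

(** Both [f] and a right inverse [g] chosen on the image are 1-Lipschitz. Preservation of distances
    also makes [f] injective on [A], so [g] recovers all of [A]. *)
Lemma hausdorff_isometry s (A : set 'rV[R]_n) (f : 'rV[R]_n -> 'rV[R]_m) :
  (forall x y, A x -> A y -> enorm (f x - f y) = enorm (x - y)) ->
  hausdorff s (f @` A) = hausdorff s A.
Proof.
move=> fE; apply/eqP; rewrite eq_le; apply/andP; split.
  have := @hausdorff_lipschitz R n m A f 1 ltr01.
  move=> /(_ (ltac:(by move=> x y Ax Ay; rewrite mul1r fE)) s).
  by rewrite expr1n mul1e.
have [->|/set0P[x0 Ax0]] := eqVneq A set0; first by rewrite hausdorff0 hausdorff_ge0.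
pose g (y : 'rV[R]_m) : 'rV[R]_n := xget 0 (A `&` f @^-1` [set y]).
have gP y : (f @` A) y -> A (g y) /\ f (g y) = y.
  move=> [x Ax fxy]; have : (A `&` f @^-1` [set y]) x by [].
  by move=> /(xgetI 0)[].
have := @hausdorff_lipschitz R m n (f @` A) g 1 ltr01.
have glip x y : (f @` A) x -> (f @` A) y -> enorm (g x - g y) <= 1 * enorm (x - y).
  by move=> /gP[Ax fx] /gP[Ay fy]; rewrite mul1r -fE// fx fy.
move=> /(_ glip s); rewrite expr1n mul1e; apply: le_trans.
apply: le_hausdorff => x Ax; have fAx : (f @` A) (f x) by exists x.
exists (f x) => //; have [Ag fg] := gP _ fAx.
apply/rowP => i; apply/eqP; rewrite -subr_eq0 -normr_le0.
have := le_coord_enorm (g (f x) - x) i; rewrite !mxE => /le_trans; apply.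
rewrite -fE// fg subrr /enorm big1 ?sqrtr0// => j _.
by rewrite mxE expr0n.
Qed.

End isometry.

(** The dilation by b is Lipschitz with constant b, which gives one inequality; the other is the
    same bound for the dilation by [a^-1]. *)
Lemma hausdorff_cube (R : realType) k (a : R) : 0 < a ->
  hausdorff k (cube k a) = ((a ^+ k)%:E * hausdorff k (cube k (1 : R)))%E.
Proof.
have scale (b c : R) : 0 < b -> 0 < c ->
    (hausdorff k (cube k (b * c)) <= (b ^+ k)%:E * hausdorff k (cube k c))%E.
  move=> b0 c0; apply: le_trans (_ : _ <= hausdorff k ((fun x => b *: x) @` cube k c))%E _.
    apply: le_hausdorff => u ubc; exists (b^-1 *: u).
      by move=> i; rewrite mxE normrM gtr0_norm ?invr_gt0// ltr_pdivrMl.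
    by rewrite scalerA divff ?scale1r// gt_eqF.
  apply: hausdorff_lipschitz => // x y _ _.
  by rewrite -scalerBr enormZ gtr0_norm.
move=> a0; apply/eqP; rewrite eq_le; apply/andP; split.
  by rewrite -[in leLHS](mulr1 a) scale.
rewrite -lee_pdivlMl ?exprn_gt0// -exprVn.
by have := scale a^-1 a; rewrite mulVf ?gt_eqF// invr_gt0; apply.
Qed.

Lemma continuous_mulmx (R : realType) d n (A : 'M[R]_(d, n)) j :
  continuous (fun x : 'rV[R]_d => (x *m A) ord0 j).
Proof.
rewrite (_ : (fun x => _) = fun x : 'rV[R]_d => \sum_(i <- index_enum 'I_d) x ord0 i * A i j);
  last by apply/funext => x; rewrite mxE.
elim: (index_enum _) => [|i s IH] x.
  rewrite (_ : (fun x => _) = fun=> 0); first exact: cst_continuous.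
  by apply/funext => y; rewrite big_nil.
rewrite (_ : (fun x => _) = fun x : 'rV[R]_d =>
    x ord0 i * A i j + \sum_(i <- s) x ord0 i * A i j); last first.
  by apply/funext => y; rewrite big_cons.
apply: (@continuousD _ _ _ (fun x : 'rV[R]_d => x ord0 i * A i j)); last exact: IH.
apply: (@continuousM _ _ (fun x : 'rV[R]_d => x ord0 i) (fun=> A i j)).
  exact: coord_continuous.
exact: cst_continuous.
Qed.

Lemma measurable_mulmx (R : realType) d s n (A : 'M[R]_(d, n)) j :
  measurable_fun setT (fun x : caratheodory_type (@hausdorff R d s) => (x *m A) ord0 j).
Proof.
rewrite (_ : (fun x => _) = (fun x : caratheodory_type (@hausdorff R d s) =>
    \sum_(i <- index_enum 'I_d) x ord0 i * A i j)); last first.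
  by apply/funext => x; rewrite mxE.
apply: (@measurable_sum _ (caratheodory_type (@hausdorff R d s)) R setT 'I_d
  (index_enum 'I_d) (fun i x => x ord0 i * A i j)) => i.
apply: (@measurable_funM _ (caratheodory_type (@hausdorff R d s)) R setT
  (fun x => x ord0 i) (fun=> A i j)).
  exact: measurable_coord.
exact: measurable_cst.
Qed.

(** The frame [L] will satisfy [L *m L^T = 1%:M]: its rows are then an orthonormal basis of a plane
    through 0, and [u *m L] is the point with coordinates [u] in that basis. *)
Definition plane_cube (R : realType) (k d : nat) (L : 'M[R]_(k, d)) (a : R) : set 'rV[R]_d :=
  (fun u => u *m L) @` cube k a.

Section plane_cube.
Context {R : realType} {k d : nat}.
Variable L : 'M[R]_(k, d).
Hypothesis LLT : L *m L^T = 1%:M.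

Let enorm_mulmx (u : 'rV[R]_k) : enorm (u *m L) = enorm u.
Proof.
have sqE n (x : 'rV[R]_n) : \sum_i x ord0 i ^+ 2 = (x *m x^T) ord0 ord0.
  by rewrite mxE; apply: eq_bigr => i _; rewrite mxE expr2.
by rewrite /enorm !sqE trmx_mul mulmxA -(mulmxA u) LLT mulmx1.
Qed.

Lemma hausdorff_plane_cube (a : R) : 0 < a ->
  hausdorff k (plane_cube L a) = ((a ^+ k)%:E * hausdorff k (cube k (1 : R)))%E.
Proof.
move=> a0; rewrite -hausdorff_cube//; apply: hausdorff_isometry => x y _ _.
by rewrite -mulmxBl enorm_mulmx.
Qed.

(** [L^T *m L] is the orthogonal projection onto the plane. This describes the cube by linear
    equations and strict inequalities, from which measurability and relative openness are read
    off. *)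
Lemma plane_cubeE (a : R) : plane_cube L a =
  [set x | x = x *m (L^T *m L) /\ cube k a (x *m L^T)].
Proof.
apply/seteqP; split => [_ [u ua <-]|x [xE xa]] /=.
  by rewrite !mulmxA -(mulmxA u) LLT mulmx1.
by exists (x *m L^T) => //; rewrite -mulmxA -xE.
Qed.

Lemma measurable_plane_cube (s : nat) (a : R) :
  measurable (plane_cube L a : set (caratheodory_type (@hausdorff R d s))).
Proof.
rewrite plane_cubeE.
have -> : [set x | x = x *m (L^T *m L) /\ cube k a (x *m L^T)] =
    (\bigcap_(j in [set: 'I_d]) ((fun x => (x *m (1%:M - L^T *m L)) ord0 j) @^-1` [set 0])) `&`
    (\bigcap_(j in [set: 'I_k]) ((fun x => (x *m L^T) ord0 j) @^-1` `]-a, a[%classic)).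
  apply/seteqP; split => x /=.
    move=> [xE xa]; split => j _ /=; first by rewrite mulmxBr mulmx1 -xE subrr mxE.
    by rewrite in_itv/= -ltr_norml.
  move=> [xE xa]; split; last first.
    by move=> j; have := xa j I; rewrite /= in_itv/= -ltr_norml.
  apply/rowP => j; have := xE j I; rewrite /= mulmxBr mulmx1 !mxE => /eqP.
  by rewrite subr_eq0 => /eqP.
apply: measurableI; apply: fin_bigcap_measurable => // j _.
  by rewrite -[X in measurable X]setTI; exact: measurable_mulmx.
by rewrite -[X in measurable X]setTI; exact: measurable_mulmx.
Qed.

Lemma plane_cube_geodesic (C0 a : R) : 0 < a ->
  hausdorff k (plane_cube L a) = 1%E -> Num.sqrt k%:R * a < C0 ->
  totally_geodesic k C0 (plane_cube L a).
Proof.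
move=> a0 H1 aC0.
have fullE x : (x \in (linfun (mulmxr L) @: fullv)%VS) = (x == x *m (L^T *m L)).
  apply/memv_imgP/eqP => [[u _ ->]|xE].
    by rewrite lfunE/= !mulmxA -(mulmxA u) LLT mulmx1.
  by exists (x *m L^T); rewrite ?memvf// lfunE/= -mulmxA -xE.
(* The plane is the row space of [L], through 0, and the open set is the cylinder over the cube
   orthogonal to that plane. *)
exists 0, (linfun (mulmxr L) @: fullv)%VS, [set x | cube k a (x *m L^T)], 0.
split => //.
(* The map [u *m L] is injective, since multiplying by [L^T] gives back [u]. *)
- rewrite limg_dim_eq ?dimvf ?dim_matrix; first exact: mul1n.
  apply/eqP; rewrite -subv0; apply/subvP => u; rewrite memv_cap memvf/= memv_ker.
  rewrite lfunE/= => /eqP uL0; rewrite memv0 -[u]mulmx1 -LLT mulmxA.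
  by rewrite uL0 mul0mx.
- rewrite (_ : [set x | _] = [set x : 'rV[R]_d |
      all (fun i => `|(x *m L^T) ord0 i| < a) (index_enum 'I_k)]).
    elim: (index_enum _) => [|i e IH]; first by rewrite [X in open X]set_true; exact: openT.
    rewrite (_ : [set x | _] = ((fun x => (x *m L^T) ord0 i) @^-1` ball 0 a) `&`
       [set x | all (fun i => `|(x *m L^T) ord0 i| < a) e]).
      apply: openI => //; apply: open_comp; last exact: ball_open.
      by move=> x _; exact: continuous_mulmx.
    apply/seteqP; split => x /=; rewrite -ball_normE /ball_/= sub0r normrN.
      by move=> /andP[].
    by move=> [-> ->].
  apply/seteqP; split => x /= xa; first by apply/allP => i _; exact: xa.
  by move=> i; move/allP : xa; apply; rewrite mem_index_enum.
- rewrite plane_cubeE; apply/seteqP; split => x; rewrite /affine_plane/= subr0 fullE.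
    by move=> [/eqP].
  by move=> [/eqP].
- move=> _ [u ua <-]; rewrite /eball/= subr0 enorm_mulmx.
  apply: le_lt_trans aC0; rewrite -[X in _ * X]gtr0_norm//.
  by apply: le_enorm => i; exact/ltW/ua.
Qed.

End plane_cube.

(** With h the measure of the cube of half-side 1, normalization forces a^k = 1/h. The lower bound
    on h and [unit_ball_volume_sqr] give a^k <= 2^k / omega_k <= k^(k/2), so a <= sqrt(k). *)
Lemma normalized_cube (R : realType) k : (0 < k)%N ->
  exists a : R, [/\ 0 < a, Num.sqrt k%:R * a <= k%:R, a <= k%:R &
    ((a ^+ k)%:E * hausdorff k (cube k (1 : R)))%E = 1%E].
Proof.
move=> k0; have hge := @hausdorff_cube_ge R k; have hfin := @hausdorff_cube_fin R k.
have v0 : 0 < unit_ball_volume R k.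
  rewrite lt_neqAle unit_ball_volume_ge0 andbT eq_sym; apply/eqP => vk.
  have := unit_ball_volume_sqr R k; rewrite vk expr0n mul0r.
  by rewrite leNgt exprn_gt0.
have h0 : (0 < hausdorff k (cube k (1 : R)))%E.
  by apply: lt_le_trans hge; rewrite lte_fin divr_gt0// exprn_gt0.
have [h hE] : exists h : R, hausdorff k (cube k (1 : R)) = h%:E.
  by exists (fine (hausdorff k (cube k (1 : R)))); rewrite fineK// ge0_fin_numE// ltW.
move: hge h0 {hfin}; rewrite hE lee_fin lte_fin => hge h0.
pose a := h^-1 `^ k%:R^-1.
have ak : a ^+ k = h^-1.
  rewrite -powR_mulrn ?powR_ge0// /a -powRrM mulVf ?powRr1//.
    by rewrite invr_ge0 ltW.
  by rewrite pnatr_eq0 -lt0n.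
have a0 : 0 < a by rewrite powR_gt0// invr_gt0.
have kR : 1 <= k%:R :> R by rewrite ler1n.
have sqrtk : 1 <= Num.sqrt k%:R :> R by rewrite -[leLHS]sqrtr1 ler_wsqrtr.
have aleq : Num.sqrt k%:R * a <= k%:R.
  have sa0 : 0 <= Num.sqrt k%:R * a by rewrite mulr_ge0// ltW.
  have h2 : h^-1 ^+ 2 <= k%:R ^+ k.
    apply: (@le_trans _ _ (4 ^+ k / unit_ball_volume R k ^+ 2)).
      have -> : 4 ^+ k / unit_ball_volume R k ^+ 2 =
          (unit_ball_volume R k / 2 ^+ k)^-1 ^+ 2.
        rewrite invf_div expr_div_n -exprM mulnC exprM; congr (_ ^+ _ / _).
        by rewrite expr2 -natrM.
      have w0 : 0 < unit_ball_volume R k / 2 ^+ k by rewrite divr_gt0// exprn_gt0.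
      by rewrite lerXn2r ?nnegrE ?invr_ge0 ?(ltW h0) ?(ltW w0)// lef_pV2 ?posrE.
    by rewrite ler_pdivrMr ?exprn_gt0// mulrC unit_ball_volume_sqr.
  (* Raising to the power 2k removes both the square root and the k-th root. *)
  rewrite -(@ler_pXn2r _ (2 * k)) ?nnegrE ?muln_gt0// exprM [leRHS]exprM.
  rewrite (exprMn 2) sqr_sqrtr// exprMn -(exprM a) mulnC exprM ak.
  by rewrite expr2 exprMn ler_wpM2l ?exprn_ge0.
exists a; split => //.
  by apply: le_trans aleq; rewrite ler_peMl// ltW.
by rewrite ak -EFinM mulVf// gt_eqF.
Qed.

(** * Orthogonality of exponentials *)

(** Written as a matrix product so that the continuity and measurability results for [*m] apply
    directly. *)
Definition dot (R : realType) (d : nat) (n : 'rV[int]_d) (x : 'rV[R]_d) : R :=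
  (x *m (map_mx intr n)^T) ord0 ord0.

Section dot.
Context {R : realType} {d : nat}.
Implicit Types (n : 'rV[int]_d) (x y : 'rV[R]_d).

Lemma dotE n x : dot n x = \sum_i x ord0 i * (n ord0 i)%:~R.
Proof. by rewrite /dot mxE; apply: eq_bigr => i _; rewrite !mxE. Qed.

Lemma dotDr n x y : dot n (x + y) = dot n x + dot n y.
Proof. by rewrite /dot mulmxDl mxE. Qed.

Lemma dotZr n (a : R) x : dot n (a *: x) = a * dot n x.
Proof. by rewrite /dot -scalemxAl mxE. Qed.

Lemma dotBl n n' x : dot (n - n') x = dot n x - dot n' x.
Proof.
rewrite !dotE -sumrB; apply: eq_bigr => i _.
by rewrite !mxE intrB mulrBr.
Qed.

Lemma dot_delta n i : dot n (delta_mx ord0 i : 'rV[R]_d) = (n ord0 i)%:~R.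
Proof.
rewrite dotE (bigD1 i)//= big1 ?addr0 => [|j ji].
  by rewrite mxE !eqxx mul1r.
by rewrite mxE (negbTE ji) andbF mul0r.
Qed.

Lemma continuous_dot n : continuous (@dot R d n).
Proof. exact: continuous_mulmx. Qed.

End dot.

Lemma periodic_int (R : realType) (f : R -> R) :
  (forall y, f (y + 2 * pi) = f y) ->
  forall (x : R) (m : int), f (x + m%:~R * (2 * pi)) = f x.
Proof.
move=> fp; have nat_case (y : R) (p : nat) : f (y + p%:R * (2 * pi)) = f y.
  elim: p => [|p IH]; first by rewrite mul0r addr0.
  by rewrite -natr1 mulrDl mul1r addrA fp.
move=> x [p|p]; first exact: nat_case.
by rewrite NegzE mulrNz mulNr -(nat_case _ p.+1) subrK.
Qed.

Lemma cos_2pi_int (R : realType) (x : R) (m : int) : cos (x + m%:~R * (2 * pi)) = cos x.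
Proof. by apply: periodic_int => y; rewrite (mulr_natl pi 2) cosD2pi. Qed.

Lemma sin_2pi_int (R : realType) (x : R) (m : int) : sin (x + m%:~R * (2 * pi)) = sin x.
Proof. by apply: periodic_int => y; rewrite (mulr_natl pi 2) sinD2pi. Qed.

(** * Translations and integrals over the fundamental domain *)

Section torus_integral.
Context {R : realType} {d : nat}.
Variable s : nat.
Local Notation H := (@hausdorff R d s).
Local Notation T := (caratheodory_type H).
Local Notation mu := (hausdorff_measure R d s).

Lemma hausdorff_translate (v : 'rV[R]_d) (A : set 'rV[R]_d) :
  H ((fun x => x + v) @` A) = H A.
Proof.
apply: hausdorff_isometry => x y _ _.
by rewrite opprD addrACA subrr addr0.
Qed.

Lemma preimage_translate (v : 'rV[R]_d) (A : set 'rV[R]_d) :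
  (fun x => x + v) @^-1` A = (fun x => x + (- v)) @` A.
Proof.
apply/seteqP; split => [x Ax|_ [x Ax <-]] /=; last by rewrite subrK.
by exists (x + v) => //; rewrite addrK.
Qed.

(** By translation invariance, Caratheodory's condition for the preimage of [A], tested on [X], is
    the condition for [A] tested on the translate of [X]. *)
Lemma measurable_translate (v : 'rV[R]_d) :
  measurable_fun setT ((fun x : 'rV[R]_d => x + v) : T -> T).
Proof.
move=> _ A mA; rewrite setTI.
change (H.-caratheodory ((fun x => x + v) @^-1` A)) => X.
have /(_ ((fun x => x + v) @` X)) := (mA : H.-caratheodory A).
rewrite hausdorff_translate => ->; congr (_ + _)%E.
  rewrite -(hausdorff_translate v (X `&` _)); congr H.
  apply/seteqP; split => [_ [[x Xx <-] Ax]|_ [x [Xx Ax] <-]]; first by exists x.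
  by split => //; exists x.
rewrite -(hausdorff_translate v (X `&` _)); congr H.
apply/seteqP; split => [_ [[x Xx <-] Ax]|_ [x [Xx Ax] <-]]; first by exists x.
by split => //; exists x.
Qed.

Lemma Rintegral_translate (v : 'rV[R]_d) (D : set T) (f : T -> R) :
  measurable D -> measurable_fun setT f ->
  mu.-integrable ((fun x => x + v) @^-1` D) (fun x => (f (x + v))%:E) ->
  (\int[mu]_(x in D) f x = \int[mu]_(x in (fun x => x + v) @^-1` D) f (x + v))%R.
Proof.
move=> mD mf intf; rewrite /Rintegral; congr fine.
have mEf : measurable_fun setT (EFin \o f) by exact/measurable_EFinP.
have ip := @integral_pushforward _ _ T T R _ (measurable_translate v) mu D (EFin \o f) mEf.
have {}ip := ip intf mD.
apply: (eq_trans _ ip).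
(* The push-forward of the measure under the translation is the measure itself. *)
have E : (fun A : set T => mu A) = (fun A : set T => mu ((fun x => x + v) @^-1` A)).
  by apply/funext => A; rewrite preimage_translate; exact/esym/hausdorff_translate.
exact: (congr1 (fun m => integral m D (EFin \o f)) E).
Qed.



Lemma measurable_coord_itv (i : 'I_d) (I : interval R) :
  measurable ([set x | x ord0 i \in I] : set T).
Proof.
have := @measurable_coord R d s i measurableT [set` I] (measurable_itv I).
by rewrite setTI.
Qed.

Lemma measurable_fundamental_domain : measurable (@fundamental_domain R d : set T).
Proof.
have -> : @fundamental_domain R d =
    \bigcap_(i in [set: 'I_d]) [set x | x ord0 i \in `[0, 2 * pi[].
  apply/seteqP; split => x /= xF i; first by move=> _ /=; rewrite in_itv; exact: xF.
  by have := xF i I; rewrite /= in_itv.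
by apply: fin_bigcap_measurable => // i _; exact: measurable_coord_itv.
Qed.

Lemma measurable_cos_dot (n : 'rV[int]_d) :
  measurable_fun setT ((fun x => cos (dot n x)) : T -> R).
Proof.
apply: (@measurableT_comp _ _ _ _ _ _ (@cos R)); last exact: measurable_mulmx.
by apply: continuous_measurable_fun; exact: continuous_cos.
Qed.

Lemma integrable_cos_dot (n : 'rV[int]_d) (D : set T) : measurable D ->
  (mu D < +oo)%E -> mu.-integrable D (EFin \o (fun x => cos (dot n x))).
Proof.
move=> mD Dfin; apply: measurable_bounded_integrable; [exact: mD|exact: Dfin| |].
  exact: (measurable_funS measurableT (@subsetT _ D) (measurable_cos_dot n)).
exists 1; split; first exact: num_real.
by move=> M M1 x _ /=; rewrite (le_trans (cos_max _))// ltW.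
Qed.

Lemma Rintegral_cos_dot_eq0 (n : 'rV[int]_d) : n != 0 ->
  (mu (@fundamental_domain R d) < +oo)%E ->
  (\int[mu]_(x in @fundamental_domain R d) cos (dot n x) = 0)%R.
Proof.
move=> n0 Ffin; set F := @fundamental_domain R d.
(* With w half a period of the integrand in the i-th direction, F is cut at
   height 2 pi - w and both pieces are translated by w modulo 2 pi: this permutes
   F and changes the sign of the integrand. *)
have [i ni0] : exists i, n ord0 i != 0.
  apply/existsP; rewrite -negb_forall; apply: contra n0 => /forallP h.
  by apply/eqP/rowP => j; rewrite mxE; exact/eqP.
pose N : R := (n ord0 i)%:~R.
have N1 : 1 <= `|N| by rewrite -intr_norm ler1z -gtz0_ge1 normr_gt0.
have N0 : 0 < `|N| by rewrite (lt_le_trans _ N1).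
pose w : R := pi / `|N|.
have w0 : 0 < w by rewrite divr_gt0// pi_gt0.
(* A nonzero integer has absolute value at least 1; this keeps both cuts, at [w] and at
   [2 * pi - w], inside the period. *)
have wpi : w <= pi by rewrite ler_pdivrMr// ler_peMr// pi_ge0.
have pi0 : 0 < pi :> R by exact: pi_gt0.
have cosw y : cos (y + w * N) = - cos y.
  rewrite /w; have [N_ge0|N_lt0] := leP 0 N.
    by rewrite ger0_norm// divfK ?cosDpi// -normr_gt0.
  rewrite ltr0_norm// invrN mulrN mulNr divfK ?lt_eqF//.
  by rewrite -[in RHS](subrK pi y) cosDpi opprK.
pose v (a : R) : 'rV[R]_d := a *: delta_mx ord0 i.
have vE a (x : 'rV[R]_d) j : (x + v a) ord0 j = x ord0 j + (if j == i then a else 0).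
  by rewrite !mxE eqxx /=; case: eqP => _; rewrite ?mulr1 ?mulr0.
(* Only coordinate [i] moves, so the preimage is determined by three conditions on one real
   variable. *)
have vF a (I J : interval R) : (forall t, 0 <= t + a < 2 * pi -> t + a \in J -> t \in I) ->
    (forall t, 0 <= t < 2 * pi -> t \in I -> (t + a \in J) && (0 <= t + a < 2 * pi)) ->
    (forall t, 0 <= t + a < 2 * pi -> t + a \in J -> 0 <= t < 2 * pi) ->
    (fun x => x + v a) @^-1` (F `&` [set x | x ord0 i \in J]) =
    F `&` [set x | x ord0 i \in I].
  move=> JI IJ Jb; apply/seteqP; split => x /= [xF xi].
    move: xi; rewrite vE eqxx => xi; have := xF i; rewrite vE eqxx => xFi.
    split; last exact: JI.
    move=> j; have := xF j; rewrite vE; case: eqP => [-> _|_]; last by rewrite addr0.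
    exact: Jb.
  have /andP[h1 h2] := IJ _ (xF i) xi.
  split; last by rewrite vE eqxx.
  by move=> j; rewrite vE; case: eqP => [->|_]; rewrite ?addr0.
have mFI (I : interval R) : measurable (F `&` [set x | x ord0 i \in I] : set T).
  exact: (@measurableI _ T _ _ measurable_fundamental_domain (measurable_coord_itv i I)).
have FIfin (I : interval R) : (mu (F `&` [set x | x ord0 i \in I] : set T) < +oo)%E.
  by apply: le_lt_trans Ffin; apply: le_hausdorff => x [].
have shift a (I J : interval R) : (fun x => x + v a) @^-1` (F `&` [set x | x ord0 i \in J]) =
    F `&` [set x | x ord0 i \in I] -> (forall y, cos (y + a * N) = - cos y) ->
    (\int[mu]_(x in F `&` [set x | x ord0 i \in J]) cos (dot n x) =
     - \int[mu]_(x in F `&` [set x | x ord0 i \in I]) cos (dot n x))%R.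
  move=> EIJ ca; have fE x : cos (dot n (x + v a)) = -1 * cos (dot n x).
    by rewrite dotDr dotZr dot_delta ca mulN1r.
  rewrite (@Rintegral_translate (v a)).
  - rewrite EIJ -mulN1r -RintegralZl.
    + by congr fine; apply: eq_integral => x _; rewrite fE.
    + exact: mFI.
    + exact: integrable_cos_dot.
  - exact: mFI.
  - exact: measurable_cos_dot.
  - rewrite EIJ (_ : (fun x => _) = (fun x => (-1)%:E * (cos (dot n x))%:E)%E); last first.
      by apply/funext => x; rewrite fE EFinM.
    by apply: integrableZl; [exact: mFI|exact: integrable_cos_dot].
have splitF b : F = (F `&` [set x | x ord0 i \in `]-oo, b[]) `|`
                    (F `&` [set x | x ord0 i \in `[b, +oo[]) :> set T.
  rewrite -setIUr; apply/seteqP; split => [x xF|x []//]; split => //=.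
  by rewrite !in_itv/= andbT; have [|] := ltP (x ord0 i) b; [left|right].
have intF b : (\int[mu]_(x in F) cos (dot n x) =
    \int[mu]_(x in F `&` [set x | x ord0 i \in `]-oo, b[]) cos (dot n x) +
    \int[mu]_(x in F `&` [set x | x ord0 i \in `[b, +oo[]) cos (dot n x))%R.
  rewrite {1}(splitF b) Rintegral_setU//.
  - by rewrite -splitF; apply: integrable_cos_dot => //; exact: measurable_fundamental_domain.
  - apply/disj_setPS => x [[_ /= h1] [_ /= h2]].
    by move: h1 h2; rewrite !in_itv/= andbT ltNge => /negP.
have I0 := intF w.
(* The part of F above [w] is the lower piece moved by [w], the part below [w] the upper piece moved
   by [w - 2 * pi]. *)
rewrite (shift w `]-oo, 2 * pi - w[ `[w, +oo[) in I0; last 2 first.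
- apply: vF => t; rewrite !in_itv/= ?andbT.
  + by move=> /andP[_ ?] ?; lra.
  + by move=> /andP[? ?] ?; apply/andP; split; [|apply/andP; split]; lra.
  + by move=> /andP[? ?] ?; apply/andP; split; lra.
- exact: cosw.
rewrite (shift (w - 2 * pi) `[2 * pi - w, +oo[ `]-oo, w[) in I0; last 2 first.
- apply: vF => t; rewrite !in_itv/= ?andbT.
  + by move=> /andP[? _] ?; lra.
  + by move=> /andP[? ?] ?; apply/andP; split; [|apply/andP; split]; lra.
  + by move=> /andP[? ?] ?; apply/andP; split; lra.
(* The additional shift by -2 pi changes the phase by an integer multiple of 2 pi. *)
- move=> y; rewrite mulrBl addrA -cosw -[LHS](cos_2pi_int _ (n ord0 i)).
  by congr cos; rewrite /N; ring.
(* The two pieces reassemble to F with the opposite sign, so the integral equals its own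
   negative. *)
by move: I0; rewrite -opprD -[in X in _ = - X]addrC -intF => /eqP; rewrite -addr_eq0 -mulr2n mulrn_eq0/= => /eqP.
Qed.

End torus_integral.

(** * L2 norms of sums of exponentials *)

Definition trig_sum (R : realType) (d : nat) (S : seq 'rV[int]_d) (x : 'rV[R]_d) : R[i] :=
  Complex (\sum_(m <- S) cos (dot m x)) (\sum_(m <- S) sin (dot m x)).

Definition sqr_modulus (R : realType) (z : R[i]) : R := complex.Re z ^+ 2 + complex.Im z ^+ 2.

Section L2.
Context {R : realType} {d : nat}.
Variable s : nat.
Local Notation H := (@hausdorff R d s).
Local Notation T := (caratheodory_type H).
Local Notation mu := (hausdorff_measure R d s).

Lemma sqr_modulus_ge0 (z : R[i]) : 0 <= sqr_modulus z.
Proof. by rewrite addr_ge0// sqr_ge0. Qed.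

Lemma L2normE (A : set 'rV[R]_d) (u : 'rV[R]_d -> R[i]) :
  L2norm s A u = ((\int[mu]_(x in A) (sqr_modulus (u x))%:E) `^ 2^-1)%E.
Proof.
rewrite /L2norm unlock /Lnorm; congr (_ `^ _)%E.
rewrite [RHS]integral_mkcond; apply: eq_integral => x _.
rewrite !patchE; case: ifPn => _; last by rewrite abse0 poweR0r// lt0r_neq0.
rewrite abse_EFin poweR_EFin; congr EFin.
rewrite powR_mulrn// ger0_norm; last by case: (u x) => a b; exact: sqrtr_ge0.
by rewrite /sqr_modulus; case: (u x) => a b /=; rewrite sqr_sqrtr// addr_ge0 ?sqr_ge0.
Qed.

(** This expansion serves three ends: measurability, the mean over the torus, and the pointwise
    bounds on the cap eigenfunction. *)
Lemma sqr_modulus_trig_sum (S : seq 'rV[int]_d) (x : 'rV[R]_d) :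
  sqr_modulus (trig_sum S x) = \sum_(m <- S) \sum_(m' <- S) cos (dot (m - m') x).
Proof.
rewrite /sqr_modulus /= !expr2 !big_distrlr/= -big_split/=.
apply: eq_bigr => m _; rewrite -big_split/=; apply: eq_bigr => m' _.
by rewrite dotBl cosB.
Qed.

Lemma measurable_trig_sum (S : seq 'rV[int]_d) :
  measurable_fun setT ((fun x => sqr_modulus (trig_sum S x)) : T -> R).
Proof.
rewrite (_ : (fun x => _) = fun x : T => \sum_(m <- S) \sum_(m' <- S) cos (dot (m - m') x)).
  apply: (@measurable_sum _ T R setT _ S (fun m x => \sum_(m' <- S) cos (dot (m - m') x))) => m.
  apply: (@measurable_sum _ T R setT _ S (fun m' x => cos (dot (m - m') x))) => m'.
  exact: measurable_cos_dot.
by apply/funext => x; rewrite sqr_modulus_trig_sum.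
Qed.

Lemma integral_le_cst (A : set T) (g : T -> R) (M : R) : measurable A ->
  measurable_fun setT g -> (forall x, 0 <= g x) -> (forall x, A x -> g x <= M) ->
  (\int[mu]_(x in A) (g x)%:E <= M%:E * mu A)%E.
Proof.
move=> mA mg g0 gM; rewrite -integral_cst//; apply: ge0_le_integral.
- exact: mA.
- by move=> x _; rewrite lee_fin.
- by apply/measurable_EFinP; exact: (measurable_funS measurableT (@subsetT _ A) mg).
- exact: measurable_cst.
- by move=> x Ax; rewrite lee_fin gM.
Qed.

Lemma integral_ge_cst (A B : set T) (g : T -> R) (c : R) : measurable A -> measurable B ->
  B `<=` A -> 0 <= c ->
  measurable_fun setT g -> (forall x, 0 <= g x) -> (forall x, B x -> c <= g x) ->
  (c%:E * mu B <= \int[mu]_(x in A) (g x)%:E)%E.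
Proof.
move=> mA mB BA c0 mg g0 cg.
have mgD (D : set T) : measurable_fun D (EFin \o g).
  by apply/measurable_EFinP; exact: (measurable_funS measurableT (@subsetT _ D) mg).
apply: (@le_trans _ _ (\int[mu]_(x in B) (g x)%:E)%E); last first.
  apply: ge0_subset_integral; [exact: mB|exact: mA|exact: mgD| |exact: BA].
  by move=> x _; rewrite lee_fin.
rewrite -integral_cst//; apply: ge0_le_integral.
- exact: mB.
- by move=> x _; rewrite lee_fin.
- exact: measurable_cst.
- exact: mgD.
- by move=> x Bx; rewrite lee_fin cg.
Qed.

(** Parseval's identity: off-diagonal cosines integrate to 0, and since [S] has no repetitions the
    diagonal consists of exactly [size S] terms equal to 1. *)
Lemma integral_trig_sum (S : seq 'rV[int]_d) : uniq S ->
  (mu (@fundamental_domain R d) < +oo)%E ->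
  (\int[mu]_(x in @fundamental_domain R d) (sqr_modulus (trig_sum S x))%:E =
   ((size S)%:R)%:E * mu (@fundamental_domain R d))%E.
Proof.
move=> uS Ffin; set F := @fundamental_domain R d.
have mF : measurable (F : set T) by exact: measurable_fundamental_domain.
have int m : mu.-integrable F (EFin \o (fun x => cos (dot m x))).
  exact: integrable_cos_dot.
have intE m : (\int[mu]_(x in F) (cos (dot m x))%:E = (m == 0)%:R%:E * mu F)%E.
  have [->|m0] := eqVneq m 0.
    rewrite mul1e -[RHS]mul1e -integral_cst//; apply: eq_integral => x _.
    by rewrite dotE big1 ?cos0// => i _; rewrite mxE mulr0.
  rewrite mul0e -[LHS]fineK; last exact: (integrable_fin_num mF (int m)).
  by have := Rintegral_cos_dot_eq0 m0 Ffin; rewrite /Rintegral => ->.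
transitivity (\sum_(m <- S) \sum_(m' <- S) \int[mu]_(x in F) (cos (dot (m - m') x))%:E)%E.
  under eq_integral do rewrite sqr_modulus_trig_sum -sumEFin.
  under eq_integral do under eq_bigr do rewrite -sumEFin.
  have int2 m : mu.-integrable F (fun x => \sum_(m' <- S) (cos (dot (m - m') x))%:E)%E.
    by apply: (integrable_sum mF) => m' _; exact: int.
  rewrite (integral_sum mF int2); apply: eq_bigr => m _.
  by rewrite (integral_sum mF (fun m' => int (m - m'))).
transitivity (\sum_(m <- S) mu F)%E.
  apply: eq_big_seq => m mS; rewrite (bigD1_seq m)//= intE subrr eqxx mul1e.
  by rewrite big1 ?adde0// => m' m'm; rewrite intE subr_eq0 eq_sym (negbTE m'm) mul0e.
have <- : ((fine (mu F))%:E = mu F)%E by rewrite fineK// ge0_fin_numE.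
by rewrite sumEFin -EFinM big_const_seq count_predT iter_addr_0 mulr_natl.
Qed.

End L2.

(** * Eigenfunctions *)

Section derivatives.
Context {R : realType} {d : nat}.
Implicit Types (f g : 'rV[R]_d -> R) (x v : 'rV[R]_d).

(** Reduction to functions of one real variable, where the chain rule is available. *)
Lemma is_derive_line f x v (l : R) :
  is_derive x v f l <-> is_derive (0 : R) 1 (fun h : R => f (h *: v + x)) l.
Proof.
have E : (fun h : R => h^-1 *: ((f \o shift x) (h *: v) - f x)) =
    (fun h : R => h^-1 *: (((fun h : R => f (h *: v + x)) \o shift 0) (h *: 1) -
       (fun h : R => f (h *: v + x)) 0)).
  by apply/funext => h /=; rewrite addr0 scale0r add0r [h *: 1]mulr1.
by split => -[h1 h2]; split; move: h1 h2; rewrite /derivable /derive E.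
Qed.

Lemma partial_eq i f f' : (forall x, is_derive x (delta_mx ord0 i) f (f' x)) ->
  partial i f = f'.
Proof. by move=> h; apply/funext => x; have [] := h x. Qed.

(** Regularity and the formula for the partial derivatives are proved together, so that second
    derivatives can be found by rewriting with the first ones. *)
Lemma is_C1_derive f (f' : 'I_d -> 'rV[R]_d -> R) :
  (forall i x, is_derive x (delta_mx ord0 i) f (f' i x)) ->
  (forall i, continuous (f' i)) ->
  is_C1 f /\ forall i, partial i f = f' i.
Proof.
move=> h c; have E i : partial i f = f' i by apply: partial_eq; exact: h.
by split => // i; split => [x|]; [have [] := h i x|rewrite E].
Qed.

Lemma is_C1P f i x : is_C1 f -> is_derive x (delta_mx ord0 i) f (partial i f x).
Proof. by move=> /(_ i)[/(_ x) fd _]; split. Qed.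

Lemma is_C1D f g : is_C1 f -> is_C1 g ->
  is_C1 (fun x => f x + g x) /\
  forall i, partial i (fun x => f x + g x) = fun x => partial i f x + partial i g x.
Proof.
move=> fC gC; apply: is_C1_derive => [i x|i].
  by apply: is_deriveD; exact: is_C1P.
by move=> x; apply: continuousD; [exact: (fC i).2|exact: (gC i).2].
Qed.

Lemma is_C1Z (a : R) f : is_C1 f ->
  is_C1 (fun x => a * f x) /\
  forall i, partial i (fun x => a * f x) = fun x => a * partial i f x.
Proof.
move=> fC; apply: is_C1_derive => [i x|i].
  by apply: is_deriveZ; exact: is_C1P.
by move=> x; apply: continuousM; [exact: cst_continuous|exact: (fC i).2].
Qed.

Lemma is_derive_affine (a b : R) : is_derive (0 : R) 1 (fun h : R => h * a + b) a.
Proof.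
have -> : (fun h : R => h * a + b) = (fun h : R => a * h + b).
  by apply/funext => h; rewrite mulrC.
by apply: is_derive_eq; rewrite addr0 [LHS]mulr1.
Qed.

Lemma is_C1_comp_dot (n : 'rV[int]_d) (phi phi' : R -> R) :
  (forall t : R, is_derive t 1 phi (phi' t)) -> continuous phi' ->
  is_C1 (fun x : 'rV[R]_d => phi (dot n x)) /\
  forall i, partial i (fun x => phi (dot n x)) =
            fun x => (n ord0 i)%:~R * phi' (dot n x).
Proof.
move=> hphi cphi; apply: is_C1_derive => [i x|i x].
  apply/is_derive_line.
  rewrite (_ : (fun h => _) = phi \o (fun h : R => h * (n ord0 i)%:~R + dot n x)); last first.
    by apply/funext => h /=; rewrite dotDr dotZr dot_delta.
  rewrite [X in is_derive _ _ _ X]mulrC; apply: is_derive1_comp.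
    by rewrite mul0r add0r; exact: hphi.
  exact: is_derive_affine.
apply: (@continuousM _ _ (fun=> (n ord0 i)%:~R) (fun x => phi' (dot n x))).
  exact: cst_continuous.
by apply: continuous_comp; [exact: continuous_dot|exact: cphi].
Qed.

(** For signs [e j] these are the translations composed with reflections in coordinate hyperplanes,
    all of which commute with the Laplacian. *)
Definition signed_shift (e : 'I_d -> R) (v x : 'rV[R]_d) : 'rV[R]_d :=
  \row_j (e j * x ord0 j + v ord0 j).

Lemma continuous_signed_shift (e : 'I_d -> R) v : (forall j, `|e j| = 1) ->
  continuous (signed_shift e v).
Proof.
move=> e1 x; move=> A /nbhs_ballP[eps /= eps0 epsA]; apply/nbhs_ballP; exists eps => //= y xy.
apply: epsA; split=> // i j; have := xy.2 i j; rewrite (ord1 i) -!ball_normE /ball_/= !mxE.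
by rewrite opprD addrACA subrr addr0 -mulrBr normrM e1 mul1r.
Qed.

Lemma is_C1_signed_shift (e : 'I_d -> R) v f : (forall j, `|e j| = 1) -> is_C1 f ->
  is_C1 (fun x => f (signed_shift e v x)) /\
  forall i, partial i (fun x => f (signed_shift e v x)) =
            fun x => e i * partial i f (signed_shift e v x).
Proof.
move=> e1 fC; apply: is_C1_derive => [i x|i x].
  apply/is_derive_line.
  rewrite (_ : (fun h => _) =
    (fun h : R => f (h *: delta_mx ord0 i + signed_shift e v x)) \o (fun h : R => h * e i + 0)); last first.
    apply/funext => h /=; congr f; apply/rowP => j; rewrite !mxE eqxx/=.
    by case: eqVneq => [->|_]; rewrite ?mulr1 ?mulr0 ?mul0r; ring.
  rewrite [X in is_derive _ _ _ X]mulrC; apply: is_derive1_comp.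
    by rewrite mul0r add0r; apply/is_derive_line; exact: is_C1P.
  exact: is_derive_affine.
apply: (@continuousM _ _ (fun=> e i) (fun x => partial i f (signed_shift e v x))).
  exact: cst_continuous.
by apply: (@continuous_comp _ _ _ (signed_shift e v)); [exact: continuous_signed_shift|exact: (fC i).2].
Qed.

Definition real_eigenfunction (la : R) f :=
  is_C2 f /\ forall x, - laplacian f x = la * f x.

Lemma real_eigenfunctionD la f g : real_eigenfunction la f -> real_eigenfunction la g ->
  real_eigenfunction la (fun x => f x + g x).
Proof.
move=> [[f1 f2] fE] [[g1 g2] gE]; have [h1 h2] := is_C1D f1 g1.
split.
  split; first exact: h1.
  by move=> i; rewrite h2; have [] := is_C1D (f2 i) (g2 i).
move=> x; rewrite mulrDr -fE -gE -opprD /laplacian -big_split/=; congr (- _).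
by apply: eq_bigr => i _; rewrite h2 (is_C1D (f2 i) (g2 i)).2.
Qed.

Lemma real_eigenfunctionZ la (a : R) f : real_eigenfunction la f ->
  real_eigenfunction la (fun x => a * f x).
Proof.
move=> [[f1 f2] fE]; have [h1 h2] := is_C1Z a f1.
split.
  split; first exact: h1.
  by move=> i; rewrite h2; have [] := is_C1Z a (f2 i).
move=> x; rewrite mulrCA -fE mulrN /laplacian mulr_sumr; congr (- _).
by apply: eq_bigr => i _; rewrite h2 (is_C1Z a (f2 i)).2.
Qed.

Lemma real_eigenfunction0 la : real_eigenfunction la (fun=> 0).
Proof.
pose z : 'rV[R]_d -> R := fun=> 0.
have [h1 h2] : is_C1 z /\ forall i, partial i z = z.
  by apply: (@is_C1_derive z (fun=> z)) => i; exact: cst_continuous.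
rewrite -/z.
split.
  split; first exact: h1.
  by move=> i; rewrite h2.
by move=> x; rewrite mulr0 /laplacian big1 ?oppr0// => i _; rewrite -/z !h2.
Qed.

Lemma real_eigenfunction_sum la (I : eqType) (S : seq I) (f : I -> 'rV[R]_d -> R) :
  (forall m, m \in S -> real_eigenfunction la (f m)) ->
  real_eigenfunction la (fun x => \sum_(m <- S) f m x).
Proof.
elim: S => [_|m S IH h].
  rewrite (_ : (fun x => _) = fun=> 0); first exact: real_eigenfunction0.
  by apply/funext => x; rewrite big_nil.
rewrite (_ : (fun x => _) = fun x => f m x + \sum_(m <- S) f m x); last first.
  by apply/funext => x; rewrite big_cons.
apply: real_eigenfunctionD; first by apply: h; rewrite mem_head.
by apply: IH => m' m'S; apply: h; rewrite inE m'S orbT.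
Qed.

(** Each derivative in direction i brings out a factor [e i], and the square of a sign is 1. *)
Lemma real_eigenfunction_signed_shift la (e : 'I_d -> R) v f : (forall j, `|e j| = 1) ->
  real_eigenfunction la f -> real_eigenfunction la (fun x => f (signed_shift e v x)).
Proof.
move=> e1 [[f1 f2] fE]; have [h1 h2] := is_C1_signed_shift v e1 f1.
have g2 i := is_C1_signed_shift v e1 (f2 i).
split.
  split; first exact: h1.
  by move=> i; rewrite h2; have [] := is_C1Z (e i) (g2 i).1.
have ee i : e i * e i = 1 by rewrite -expr2 -real_normK ?num_real// e1 expr1n.
have pp i : partial i (partial i (fun x => f (signed_shift e v x))) =
    fun x => partial i (partial i f) (signed_shift e v x).
  have [_ /(_ i) z2] := is_C1Z (e i) (g2 i).1; rewrite h2 z2.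
  by have [_ /(_ i) ->] := g2 i; apply/funext => x; rewrite mulrA ee mul1r.
move=> x; rewrite -(fE (signed_shift e v x)) /laplacian.
apply: (congr1 -%R); apply: eq_bigr => i _.
exact: (congr1 (fun k => k x) (pp i)).
Qed.

(** The hypotheses say that phi'' = -phi, so the second derivative in direction i multiplies by
    minus the square of [n ord0 i]. Cosine and sine are the two instances. *)
Lemma real_eigenfunction_comp_dot (n : 'rV[int]_d) (phi phi' : R -> R) :
  (forall t : R, is_derive t 1 phi (phi' t)) -> (forall t : R, is_derive t 1 phi' (- phi t)) ->
  real_eigenfunction (\sum_i (n ord0 i)%:~R ^+ 2) (fun x => phi (dot n x)).
Proof.
move=> h h'.
have der_cont (a b : R -> R) : (forall t : R, is_derive t 1 a (b t)) -> continuous a.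
  move=> ab t; apply: differentiable_continuous; apply/derivable1_diffP.
  by have [] := ab t.
have [g1 g2] := is_C1_comp_dot n h (der_cont _ _ h').
have [k1 k2] : is_C1 (fun x : 'rV[R]_d => phi' (dot n x)) /\ forall i, _ :=
  is_C1_comp_dot n h' (fun t => continuousN (der_cont _ _ h t)).
split.
  split; first exact: g1.
  by move=> i; rewrite g2; have [] := is_C1Z (n ord0 i)%:~R k1.
move=> x; rewrite /laplacian -sumrN mulr_suml; apply: eq_bigr => i _.
by rewrite g2 (is_C1Z _ k1).2 k2 mulrN mulrN opprK mulrA.
Qed.

Lemma real_eigenfunction_cos (n : 'rV[int]_d) :
  real_eigenfunction (\sum_i (n ord0 i)%:~R ^+ 2) (fun x => cos (dot n x)).
Proof.
exact: (@real_eigenfunction_comp_dot n _ (fun t => - sin t)).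
Qed.

Lemma real_eigenfunction_sin (n : 'rV[int]_d) :
  real_eigenfunction (\sum_i (n ord0 i)%:~R ^+ 2) (fun x => sin (dot n x)).
Proof. exact: (@real_eigenfunction_comp_dot n _ (@cos R)). Qed.

(** Since the eigenvalue is real, the complex equation splits into the same equation for the real
    and imaginary parts. *)
Lemma torus_eigenfunctionP (la : R) (u : 'rV[R]_d -> R[i]) :
  torus_eigenfunction la u <->
  [/\ torus_periodic u, real_eigenfunction la (fun x => complex.Re (u x)) &
      real_eigenfunction la (fun x => complex.Im (u x))].
Proof.
have E x : (- claplacian u x = (la%:C)%C * u x) <->
    (- laplacian (fun y => complex.Re (u y)) x = la * complex.Re (u x) /\
     - laplacian (fun y => complex.Im (u y)) x = la * complex.Im (u x)).
  rewrite /claplacian; case: (u x) => a b /=.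
  have -> : (la%:C)%C * (a +i* b)%C = ((la * a) +i* (la * b))%C.
    by apply/eqP; rewrite eq_complex/= !mul0r subr0 addr0 !eqxx.
  split => [[h1 h2]|[h1 h2]]; first by split; [exact: h1|exact: h2].
  exact: (f_equal2 (@Complex R) h1 h2).
split => [[pu r i h]|[pu [r hr] [i hi]]].
  by split => //; split => // x; have /E[] := h x.
by split => // x; apply/E.
Qed.

Lemma torus_eigenfunction_trig_sum la (S : seq 'rV[int]_d) :
  (forall m, m \in S -> \sum_i (m ord0 i)%:~R ^+ 2 = la) ->
  torus_eigenfunction la (@trig_sum R d S).
Proof.
move=> hS; apply/torus_eigenfunctionP; split.
- move=> x m; have dotE' n : dot n (x + (2 * pi) *: map_mx intr m) =
      dot n x + (\sum_i m ord0 i * n ord0 i)%:~R * (2 * pi).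
    rewrite dotDr dotZr [X in _ + X]mulrC; congr (_ + _ * _); rewrite dotE rmorph_sum.
    by apply: eq_bigr => i _; rewrite mxE -intrM.
  rewrite /trig_sum; congr Complex; apply: eq_bigr => n _.
    by rewrite dotE' cos_2pi_int.
  by rewrite dotE' sin_2pi_int.
- by apply: real_eigenfunction_sum => m /hS <-; exact: real_eigenfunction_cos.
- by apply: real_eigenfunction_sum => m /hS <-; exact: real_eigenfunction_sin.
Qed.

End derivatives.

(** * Eigenfunctions vanishing on a coordinate hyperplane *)

Section reflection.
Context {R : realType} {d : nat}.
Variables (la : R) (u : 'rV[R]_d -> R[i]).
Hypothesis la0 : la != 0.
Hypothesis ula : torus_eigenfunction la u.

(** A diagonal matrix with integer entries maps the period lattice into itself. *)
Let periodic_signed_shift (sg : 'I_d -> int) v :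
  torus_periodic (fun x => u (signed_shift (fun j => (sg j)%:~R) v x)).
Proof.
move=> x m; have [pu _ _] := (torus_eigenfunctionP la u).1 ula.
rewrite -(pu (signed_shift _ v x) (\row_j (sg j * m ord0 j))); congr u.
by apply/rowP => j; rewrite !mxE intrM; ring.
Qed.

(* u (x + v) - u (r x + v), with r the reflection in the i-th coordinate. *)
Let antisym (i : 'I_d) v (x : 'rV[R]_d) : R[i] :=
  let x1 := signed_shift (fun j => 1%:~R) v x in
  let x2 := signed_shift (fun j => (if j == i then -1 else 1 : int)%:~R) v x in
  Complex (complex.Re (u x1) + -1 * complex.Re (u x2))
          (complex.Im (u x1) + -1 * complex.Im (u x2)).

Let torus_eigenfunction_antisym i v : torus_eigenfunction la (antisym i v).
Proof.
have [pu ru iu] := (torus_eigenfunctionP la u).1 ula.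
have s1 (j : 'I_d) : `|1%:~R : R| = 1 by rewrite normr1.
have s2 (j : 'I_d) : `|(if j == i then -1 else 1 : int)%:~R : R| = 1.
  by case: eqP => _; rewrite ?normrN ?normr1.
apply/torus_eigenfunctionP; split.
- move=> x m; rewrite /antisym.
  have := periodic_signed_shift (fun=> 1) v x m => /= ->.
  by have := periodic_signed_shift (fun j => if j == i then -1 else 1) v x m => /= ->.
- apply: real_eigenfunctionD; last apply: real_eigenfunctionZ.
    exact: (real_eigenfunction_signed_shift v s1 ru).
  exact: (real_eigenfunction_signed_shift v s2 ru).
- apply: real_eigenfunctionD; last apply: real_eigenfunctionZ.
    exact: (real_eigenfunction_signed_shift v s1 iu).
  exact: (real_eigenfunction_signed_shift v s2 iu).
Qed.

Let antisym_eq0 i v (x : 'rV[R]_d) : x ord0 i = 0 -> antisym i v x = 0.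
Proof.
move=> xi; rewrite /antisym.
set y1 := signed_shift _ _ _; set y2 := signed_shift _ _ _.
have -> : y1 = y2.
  by apply/rowP => j; rewrite !mxE; case: eqP => [->|//]; rewrite xi !mulr0.
by rewrite !mulN1r !subrr.
Qed.

(** Constancy along every axis makes the Laplacian vanish, and a nonzero eigenvalue then forces f =
    0. *)
Let real_eigenfunction_cst (f : 'rV[R]_d -> R) : real_eigenfunction la f ->
  (forall i t y, f (t *: delta_mx ord0 i + y) = f y) -> forall x, f x = 0.
Proof.
move=> [_ fE] fcst x; have p0 i : partial i f = (fun=> 0).
  apply: partial_eq => y; apply/is_derive_line.
  rewrite (_ : (fun h => _) = cst (f y)); first exact: is_derive_cst.
  by apply/funext => t; rewrite fcst.
have p00 i : partial i (fun=> 0 : R) = (fun=> 0) :> ('rV[R]_d -> R).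
  by apply: partial_eq => y; exact: is_derive_cst.
apply/eqP; have := fE x; rewrite /laplacian big1 => [/eqP|i _]; last by rewrite p0 p00.
by rewrite oppr0 eq_sym mulf_eq0 (negbTE la0).
Qed.

(** By contradiction: if all antisymmetrizations were zero, [u] would be invariant under
    translations along every axis, hence zero because [la] is not 0. *)
Lemma vanishing_eigenfunction : (exists x, u x != 0) ->
  exists i (e : 'rV[R]_d -> R[i]), [/\ torus_eigenfunction la e, exists x, e x != 0 &
    forall x : 'rV[R]_d, x ord0 i = 0 -> e x = 0].
Proof.
move=> [x0 ux0]; apply: contrapT => H.
have anti0 i v x : antisym i v x = 0.
  apply: contrapT => /eqP h; apply: H; exists i, (antisym i v).
  by split; [exact: torus_eigenfunction_antisym|exists x|exact: antisym_eq0].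
have ucst i t y : u (t *: delta_mx ord0 i + y) = u y.
  (* With this base point and argument, the two reflected points are y + t e_i and y. *)
  have := anti0 i (y + (t / 2) *: delta_mx ord0 i) ((t / 2) *: delta_mx ord0 i).
  rewrite /antisym; set x1 := signed_shift _ _ _; set x2 := signed_shift _ _ _.
  have -> : x1 = t *: delta_mx ord0 i + y.
    by apply/rowP => j; rewrite !mxE; field.
  have -> : x2 = y.
    apply/rowP => j; rewrite !mxE eqxx/=; case: eqP => _; first by rewrite mulrN1z; ring.
    by rewrite !mulr0 ?addr0 ?add0r.
  move=> /eqP; rewrite eq_complex/= !mulN1r !subr_eq0 => /andP[/eqP h1 /eqP h2].
  by apply/eqP; rewrite eq_complex h1 h2 !eqxx.
have [_ ru iu] := (torus_eigenfunctionP la u).1 ula.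
move/negP : ux0; apply; rewrite eq_complex; apply/andP; split; apply/eqP.
  by apply: (real_eigenfunction_cst ru) => i t y; rewrite ucst.
by apply: (real_eigenfunction_cst iu) => i t y; rewrite ucst.
Qed.

End reflection.

(** The frame consists of k coordinate axes other than the i-th; [lift i] skips that index. *)
Lemma coordinate_plane (R : realType) (d k : nat) (i : 'I_d) : (k < d)%N ->
  exists L : 'M[R]_(k, d), L *m L^T = 1%:M /\ forall u : 'rV_k, (u *m L) ord0 i = 0.
Proof.
case: d i => [[]//|d] i kd.
have {}kd : (k <= d)%N by [].
pose f (a : 'I_k) : 'I_d.+1 := lift i (widen_ord kd a).
exists (\matrix_(a, j) (j == f a)%:R); split.
  apply/matrixP => a b; rewrite !mxE (bigD1 (f a))//= !mxE eqxx mul1r big1 ?addr0.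
    by congr (_%:R); rewrite /f (inj_eq (@lift_inj _ i)) -val_eqE.
  by move=> j ja; rewrite !mxE (negbTE ja) mul0r.
move=> u; rewrite mxE big1// => a _.
by rewrite mxE /f (negbTE (neq_lift _ _)) mulr0.
Qed.

Lemma L2norm_eq0 (R : realType) (d s : nat) (A : set 'rV[R]_d) (u : 'rV[R]_d -> R[i]) :
  (forall x, A x -> u x = 0) -> L2norm s A u = 0%E.
Proof.
move=> u0; rewrite L2normE integral0_eq => [|x Ax].
  by rewrite poweR0r// lt0r_neq0.
by rewrite u0// /sqr_modulus/= expr0n addr0.
Qed.

(** * The eigenfunction of a cap *)

(** Continuity at 0; [r] is the phase difference that will be tolerated between two frequencies of a
    cap. *)
Lemma cos_ge_half (R : realType) :
  exists2 r : R, 0 < r & forall y : R, `|y| < r -> 2^-1 <= cos y.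
Proof.
have /cvgrPdist_lt/(_ 2^-1) : cos x @[x --> (0 : R)] --> cos (0 : R).
  exact: continuous_cos.
move=> /(_ (ltac:(by rewrite invr_gt0)))/nbhs_ballP[r /= r0 rcos]; exists r => // y yr.
have := rcos y; rewrite -ball_normE /ball_/= sub0r normrN cos0 => /(_ yr).
by move=> /(le_lt_trans (ler_norm _)); lra.
Qed.

(** The domain contains a translate of the cube of half-side pi and lies in the cube of half-side 2
    pi. *)
Lemma hausdorff_fundamental_domain (R : realType) (d : nat) : (0 < d)%N ->
  exists2 h : R, 0 < h & hausdorff d (@fundamental_domain R d) = h%:E.
Proof.
move=> d0; have pi0 : 0 < pi :> R by exact: pi_gt0.
have [a [a0 _ _ acube]] := normalized_cube R d0.
have cube_gt0 (b : R) : 0 < b -> (0 < hausdorff d (cube d b))%E.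
  move=> b0; rewrite (hausdorff_cube d b0) mule_gt0 ?lte_fin ?exprn_gt0//.
  rewrite lt_neqAle hausdorff_ge0 andbT; apply/eqP => h0.
  by move: acube; rewrite -h0 mule0 => /eqP; rewrite lt_eqF// lte_fin.
have fin : (hausdorff d (@fundamental_domain R d) < +oo)%E.
  apply: (@le_lt_trans _ _ (hausdorff d (cube d (2 * pi)))).
    by apply: le_hausdorff => x xF i; have /andP[x0 xpi] := xF i; rewrite ger0_norm.
  have b0 : 0 < 2 * pi :> R by rewrite mulr_gt0.
  by rewrite (hausdorff_cube d b0) lte_mul_pinfty ?lee_fin ?exprn_ge0 ?hausdorff_cube_fin// ltW.
exists (fine (hausdorff d (@fundamental_domain R d))); last first.
  by rewrite fineK// ge0_fin_numE// hausdorff_ge0.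
rewrite fine_gt0// fin andbT; apply: (lt_le_trans (cube_gt0 _ pi0)).
rewrite -(hausdorff_translate d (const_mx pi)); apply: le_hausdorff => _ [x xpi <-] i.
by have := xpi i; rewrite ltr_norml !mxE => /andP[? ?]; apply/andP; split; lra.
Qed.

Lemma cap_dot (R : realType) (j : nat) (c0 lam : R) (zeta : 'rV[R]_j.+1) (m : 'rV[int]_j.+1) :
  0 < lam -> 0 < c0 -> enorm zeta = 1 -> lattice_cap c0 lam zeta m ->
  lam - c0 ^+ 2 / 2 <= dot m zeta <= lam.
Proof.
move=> lam0 c00 z1 [/= mlam mcap].
have z2 : \sum_i zeta ord0 i ^+ 2 = 1 by rewrite -sqr_enorm z1 expr1n.
have m2 : \sum_i (m ord0 i)%:~R ^+ 2 = lam ^+ 2 :> R.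
  by rewrite -mlam sqr_enorm; apply: eq_bigr => i _; rewrite mxE.
have E : enorm (map_mx intr m - lam *: zeta) ^+ 2 = 2 * lam * (lam - dot m zeta).
  rewrite sqr_enorm (eq_bigr (fun i => (m ord0 i)%:~R ^+ 2 +
      (lam ^+ 2 * zeta ord0 i ^+ 2 + (- (2 * lam)) * (zeta ord0 i * (m ord0 i)%:~R)))); last first.
    by move=> i _; rewrite !mxE; ring.
  by rewrite !big_split/= -!mulr_sumr m2 z2 -dotE; ring.
have h0 : 0 <= 2 * lam * (lam - dot m zeta) by rewrite -E sqr_ge0.
have h1 : 2 * lam * (lam - dot m zeta) < c0 ^+ 2 * lam.
  rewrite -E -[X in _ < _ * X]sqr_sqrtr ?ltW// -exprMn.
  by rewrite ltrXn2r ?nnegrE ?enorm_ge0// mulr_ge0 ?sqrtr_ge0// ltW.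
rewrite pmulr_rge0 ?mulr_gt0// in h0.
have h2 : 2 * (lam - dot m zeta) < c0 ^+ 2.
  by rewrite -(ltr_pM2r lam0) (le_lt_trans _ h1)// le_eqVlt; apply/orP; left; apply/eqP; ring.
by apply/andP; split; lra.
Qed.

Section cap_eigenfunction.
Context {R : realType} {j k' : nat}.
Variables (c0 lam : R) (zeta : 'rV[R]_j.+1).
Hypotheses (c00 : 0 < c0) (lam0 : 0 < lam) (zeta1 : enorm zeta = 1).

(** The first row is [zeta], padded by zeros; the others are the last k' coordinate axes. The
    frequencies below are padded in the same way, hence orthogonal to those axes. *)
Definition cap_plane : 'M[R]_(1 + k', j.+1 + k') := block_mx zeta 0 0 1%:M.

Definition cap_frequencies : seq 'rV[int]_(j.+1 + k') :=
  [seq row_mx m 0 | m <- enum_fset (fset_set (lattice_cap c0 lam zeta))].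

Lemma cap_plane_orthonormal : cap_plane *m cap_plane^T = 1%:M.
Proof.
rewrite /cap_plane tr_block_mx mulmx_block !trmx0 trmx1 !mulmx0 !mul0mx !addr0 !add0r mulmx1.
rewrite [RHS]scalar_mx_block; congr block_mx; apply/matrixP => a b; rewrite !ord1 !mxE eqxx.
rewrite -[RHS](expr1n _ 2) -zeta1 sqr_enorm; apply: eq_bigr => i _.
by rewrite mxE expr2.
Qed.

Lemma size_cap_frequencies : size cap_frequencies = cap_count c0 lam zeta.
Proof. by rewrite size_map. Qed.

Lemma cap_frequencies_uniq : uniq cap_frequencies.
Proof. by rewrite map_inj_uniq ?fset_uniq// => m m' /eq_row_mx[]. Qed.

Lemma cap_frequenciesP n : n \in cap_frequencies ->
  exists2 m, lattice_cap c0 lam zeta m & n = row_mx m 0.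
Proof.
move=> /mapP[m mC ->]; exists m => //.
by move: mC; rewrite in_fset_set ?inE//; exact: finite_lattice_cap.
Qed.

Lemma cap_frequencies_norm n : n \in cap_frequencies ->
  \sum_i (n ord0 i)%:~R ^+ 2 = lam ^+ 2 :> R.
Proof.
move=> /cap_frequenciesP[m [/= mlam _] ->]; rewrite big_split_ord/=.
rewrite [X in _ + X]big1 ?addr0 => [|i _]; last by rewrite row_mxEr mxE expr0n.
by rewrite -mlam sqr_enorm; apply: eq_bigr => i _; rewrite row_mxEl mxE.
Qed.

(** On the plane the phases depend only on the coordinate along [zeta]. *)
Lemma dot_cap_plane (m : 'rV[int]_j.+1) (u : 'rV[R]_(1 + k')) :
  dot (row_mx m 0) (u *m cap_plane) = u ord0 (lshift k' ord0) * dot m zeta.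
Proof.
rewrite /dot /cap_plane -{1}[u]hsubmxK map_row_mx tr_row_mx mul_row_block mul_row_col.
rewrite map_mx0 trmx0 !mulmx0 !addr0 -mulmxA mxE big_ord1 mxE.
by congr (_ * _).
Qed.

Lemma sqr_modulus_cap_le (x : 'rV[R]_(j.+1 + k')) :
  sqr_modulus (trig_sum cap_frequencies x) <= (cap_count c0 lam zeta)%:R ^+ 2.
Proof.
rewrite sqr_modulus_trig_sum -size_cap_frequencies.
have sum_le (S : seq 'rV[int]_(j.+1 + k')) (f : 'rV[int]_(j.+1 + k') -> R) (M : R) :
    (forall n, n \in S -> f n <= M) -> \sum_(n <- S) f n <= (size S)%:R * M.
  move=> h; rewrite big_seq (le_trans (ler_sum _ h))// -big_seq.
  by rewrite big_const_seq count_predT iter_addr_0 mulr_natl.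
rewrite expr2; apply: (@sum_le) => m _; rewrite -[leRHS]mulr1.
by apply: (@sum_le) => m' _; exact: cos_le1.
Qed.

(** By [cap_dot], the values of m.zeta on the cap differ by at most c0^2/2, so on a cube of
    half-side [b] any two phases differ by less than [r]. All N^2 cosines are then at least 1/2. *)
Lemma sqr_modulus_cap_ge (r b : R) (x : 'rV[R]_(j.+1 + k')) :
  (forall y : R, `|y| < r -> 2^-1 <= cos y) -> b * (c0 ^+ 2 / 2) <= r ->
  plane_cube cap_plane b x ->
  (cap_count c0 lam zeta)%:R ^+ 2 / 2 <= sqr_modulus (trig_sum cap_frequencies x).
Proof.
move=> hcos br [u ub <-]; rewrite sqr_modulus_trig_sum -size_cap_frequencies.
have sum_ge (S : seq 'rV[int]_(j.+1 + k')) (f : 'rV[int]_(j.+1 + k') -> R) (M : R) :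
    (forall n, n \in S -> M <= f n) -> (size S)%:R * M <= \sum_(n <- S) f n.
  move=> h; rewrite [leRHS]big_seq (le_trans _ (ler_sum _ h))// -big_seq.
  by rewrite big_const_seq count_predT iter_addr_0 mulr_natl.
rewrite expr2 -mulrA; apply: (@sum_ge) => n nC.
apply: (@sum_ge) => n' n'C; apply: hcos.
have [m mC ->] := cap_frequenciesP nC; have [m' m'C ->] := cap_frequenciesP n'C.
rewrite dotBl !dot_cap_plane -mulrBr normrM.
have /andP[? ?] := cap_dot lam0 c00 zeta1 mC; have /andP[? ?] := cap_dot lam0 c00 zeta1 m'C.
have mm' : `|dot m zeta - dot m' zeta| <= c0 ^+ 2 / 2.
  by rewrite ler_norml; apply/andP; split; lra.
apply: lt_le_trans br; apply: (@le_lt_trans _ _ (`|u ord0 (lshift k' ord0)| * (c0 ^+ 2 / 2))).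
  by rewrite ler_wpM2l.
by rewrite ltr_pM2r ?ub// divr_gt0// exprn_gt0.
Qed.

End cap_eigenfunction.

(** * The two-sided estimate *)

Lemma normalized_plane_cube (R : realType) (d k : nat) (C0 : R) (L : 'M[R]_(k, d)) :
  (0 < k)%N -> k%:R < C0 -> L *m L^T = 1%:M ->
  exists a : R, [/\ 0 < a, a <= k%:R, totally_geodesic k C0 (plane_cube L a) &
    forall eps, 0 < eps -> hausdorff k (plane_cube L (eps * a)) = (eps ^+ k)%:E].
Proof.
move=> k0 kC0 LLT; have [a [a0 ak1 ak2 H1]] := normalized_cube R k0.
exists a; split => //.
  apply: (plane_cube_geodesic LLT a0); last exact: le_lt_trans ak1 kC0.
  by rewrite (hausdorff_plane_cube LLT a0).
move=> eps eps0; rewrite (hausdorff_plane_cube LLT) ?mulr_gt0// exprMn EFinM.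
by rewrite -muleA H1 mule1.
Qed.

(** Here d = (j+1) + k' and k = 1 + k', so the caps lie on the sphere of dimension j = d - k. The
    constants are fixed before [lam]: they depend on the dimensions, on [c0] through [eps], and on
    the volume [h] of the torus. *)
Lemma cap_eigenfunction_estimates (R : realType) (j k' : nat) (c0 C0 : R) :
  (0 < j)%N -> 0 < c0 -> (j.+1 + k')%:R <= C0 ->
  exists c' C' : R, [/\ 0 < c', c' <= C' &
    forall lam : R, 1 < lam -> is_torus_eigenvalue (j.+1 + k') (lam ^+ 2) ->
      exists (Sigma : set 'rV[R]_(j.+1 + k')) (e : 'rV[R]_(j.+1 + k') -> R[i]),
        [/\ totally_geodesic (1 + k') C0 Sigma,
            torus_eigenfunction (lam ^+ 2) e,
            (exists x, e x != 0),
            ((c' * Num.sqrt (cap_number j c0 lam))%:E * torus_L2norm e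
               <= L2norm (1 + k') Sigma e)%E &
            (L2norm (1 + k') Sigma e
               <= (C' * Num.sqrt (cap_number j c0 lam))%:E
                  * torus_L2norm e)%E]].
Proof.
move=> j0 c00 dC0; set k := (1 + k')%N; set d := (j.+1 + k')%N.
have k0 : (0 < k)%N by [].
have kd : (k < d)%N by rewrite ltn_add2r ltnS.
have [h h0 hE] := @hausdorff_fundamental_domain R d isT.
have [r r0 hr] := cos_ge_half R.
have kR : 0 < k%:R :> R by rewrite ltr0n.
have kC0 : k%:R < C0 by apply: lt_le_trans dC0; rewrite ltr_nat.
have c2 : 0 < c0 ^+ 2 by rewrite exprn_gt0.
(* The cube shrunk by [eps] has half-side at most [eps * k%:R], small enough to keep the phase
   differences below [r]; the minimum with 1 keeps it inside Sigma. *)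
pose eps := Order.min 1 (r / (k%:R * c0 ^+ 2)).
have eps0 : 0 < eps by rewrite lt_min ltr01 divr_gt0// mulr_gt0.
have eps1 : eps <= 1 by rewrite ge_min lexx.
have epsr : eps * k%:R * c0 ^+ 2 <= r.
  by rewrite -mulrA -ler_pdivlMr ?mulr_gt0// ge_min lexx orbT.
have epsk : eps ^+ k <= 1 by rewrite exprn_ile1// ltW.
have epsk0 : 0 < eps ^+ k by rewrite exprn_gt0.
(* The squared norm is N h on the torus, and on Sigma it lies between N^2 eps^k / 2 and N^2; the
   constants are the square roots of these bounds divided by N^2 h. *)
exists (Num.sqrt (eps ^+ k / 2 / h)), (Num.sqrt h^-1); split.
- by rewrite sqrtr_gt0 !divr_gt0.
- by rewrite ler_wsqrtr// ler_pdivrMr// mulVf ?gt_eqF//; lra.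
move=> lam lam1 [u [ula u0]]; have lam0 : 0 < lam by apply: lt_trans lam1.
have [[zeta Sz Nz] _] := cap_number_max j c0 lam.
(* For N = 0 the upper bound demands norm 0 on Sigma, so the eigenfunction is chosen to vanish on a
   coordinate hyperplane that contains Sigma. *)
have [N0|N_gt0] := posnP (cap_count c0 lam zeta).
  have lam2 : lam ^+ 2 != 0 by rewrite expf_neq0// gt_eqF.
  have [i [e [ela e0 ei]]] := vanishing_eigenfunction lam2 ula u0.
  have [L [LLT Li]] := @coordinate_plane R d k i kd.
  have [a [a0 ak geod _]] := normalized_plane_cube k0 kC0 LLT.
  exists (plane_cube L a), e; split => //.
  - by rewrite Nz N0 sqrtr0 mulr0 mul0e L2normE poweR_ge0.
  - rewrite Nz N0 sqrtr0 mulr0 mul0e L2norm_eq0//.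
    by move=> _ [v _ <-]; exact/ei/Li.
pose L : 'M[R]_(k, d) := @cap_plane R j k' zeta.
have LLT : L *m L^T = 1%:M by exact: cap_plane_orthonormal.
have [a [a0 ak geod Ha]] := normalized_plane_cube k0 kC0 LLT.
pose S := @cap_frequencies R j k' c0 lam zeta.
pose N : R := (cap_count c0 lam zeta)%:R.
have NR : 0 < N by rewrite ltr0n.
exists (plane_cube L a), (@trig_sum R d S).
have sqrtE (I : R) : 0 <= I -> (I%:E `^ 2^-1 = (Num.sqrt I)%:E)%E.
  by move=> I0; rewrite poweR_EFin powR12_sqrt.
have Fint : torus_L2norm (@trig_sum R d S) = (Num.sqrt (N * h))%:E.
  rewrite /torus_L2norm L2normE integral_trig_sum.
  - rewrite size_cap_frequencies [X in (_ * X)%E]hE -EFinM sqrtE//.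
    by rewrite mulr_ge0// ltW.
  - exact: cap_frequencies_uniq.
  - by have := ltry h; rewrite -hE.
have mS b : measurable (plane_cube L b : set (caratheodory_type (@hausdorff R d k))).
  exact: measurable_plane_cube.
have mg := @measurable_trig_sum R d k S.
have g0 (x : 'rV[R]_d) : 0 <= sqr_modulus (trig_sum S x) by exact: sqr_modulus_ge0.
pose I := (\int[hausdorff_measure R d k]_(x in plane_cube L a)
  (sqr_modulus (trig_sum S x))%:E)%E.
have Iub : (I <= (N ^+ 2)%:E)%E.
  have /le_trans -> // := integral_le_cst (M := N ^+ 2) (mS a) mg g0
    (fun x _ => sqr_modulus_cap_le c0 lam zeta x).
  by have := Ha 1 ltr01; rewrite mul1r expr1n => H1; rewrite [X in (_ * X)%E]H1 mule1.
have Ilb : ((N ^+ 2 * (eps ^+ k / 2))%:E <= I)%E.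
  (* The integral is bounded below by its part over the concentric cube of measure eps^k, where the
     phases nearly agree. *)
  have sub : plane_cube L (eps * a) `<=` plane_cube L a.
    move=> _ [v va <-]; exists v => // i; apply: lt_le_trans (va i) _.
    by rewrite ler_piMl// ltW.
  have br : eps * a * (c0 ^+ 2 / 2) <= r.
    apply: le_trans epsr; rewrite -!mulrA ler_pM2l//.
    by rewrite ler_pM// ?divr_ge0 ?ltW//; lra.
  have := integral_ge_cst (c := N ^+ 2 / 2) (mS a) (mS (eps * a)) sub
    (ltac:(by rewrite divr_ge0// sqr_ge0)) mg g0
    (fun x => @sqr_modulus_cap_ge R j k' c0 lam zeta c00 lam0 Sz r (eps * a) x hr br).
  apply: le_trans; rewrite [X in (_ <= _ * X)%E](Ha eps eps0) -EFinM lee_fin.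
  by rewrite le_eqVlt; apply/orP; left; apply/eqP; field.
have [i iE] : exists i, I = i%:E.
  exists (fine I); rewrite fineK// ge0_fin_numE; first exact: le_lt_trans Iub (ltry _).
  by apply: integral_ge0 => x _; rewrite lee_fin.
rewrite iE !lee_fin in Iub Ilb.
have i0 : 0 <= i by apply: le_trans Ilb; rewrite mulr_ge0 ?sqr_ge0// ltW// divr_gt0.
have LS : L2norm k (plane_cube L a) (@trig_sum R d S) = (Num.sqrt i)%:E.
  by rewrite L2normE -/I iE sqrtE.
have prodE q : 0 <= q -> Num.sqrt q * Num.sqrt N * Num.sqrt (N * h) = Num.sqrt (N ^+ 2 * (q * h)).
  move=> q0; rewrite -!sqrtrM ?mulr_ge0// ?ltW//; congr Num.sqrt; ring.
split.
- exact: geod.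
- by apply: torus_eigenfunction_trig_sum => n; exact: cap_frequencies_norm.
(* At the origin all phases are 0 and the sum equals N > 0. *)
- exists 0; rewrite eq_complex negb_and; apply/orP; left; rewrite /trig_sum/=.
  rewrite (eq_bigr (fun=> 1)) => [|n _]; last first.
    by rewrite dotE big1 ?cos0// => l _; rewrite mxE mul0r.
  rewrite big_const_seq count_predT iter_addr_0 size_cap_frequencies.
  by rewrite gt_eqF.
- rewrite LS Fint Nz -EFinM lee_fin prodE; last by rewrite !divr_ge0// ltW.
  by rewrite ler_wsqrtr// divfK ?gt_eqF.
- rewrite LS Fint Nz -EFinM lee_fin prodE; last by rewrite invr_ge0 ltW.
  by rewrite ler_wsqrtr// mulVf ?gt_eqF// mulr1.
Qed.

Theorem theorem5 (R : realType) (d k : nat) (c0 C0 : R) :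
  (2 <= d)%N -> (1 <= k <= d - 1)%N -> 0 < c0 -> d%:R <= C0 ->
  exists c' C' : R, [/\ 0 < c', c' <= C' &
    forall lam : R, 1 < lam -> is_torus_eigenvalue d (lam ^+ 2) ->
      exists (Sigma : set 'rV[R]_d) (e : 'rV[R]_d -> R[i]),
        [/\ totally_geodesic k C0 Sigma,
            torus_eigenfunction (lam ^+ 2) e,
            (exists x, e x != 0),
            ((c' * Num.sqrt (cap_number (d - k) c0 lam))%:E * torus_L2norm e
               <= L2norm k Sigma e)%E &
            (L2norm k Sigma e
               <= (C' * Num.sqrt (cap_number (d - k) c0 lam))%:E
                  * torus_L2norm e)%E]].
Proof.
case: k => [//|k'] d2 /andP[_ kd] c00 dC0.
(* The first j+1 = d - k + 1 coordinates carry the cap; the remaining k' = k - 1 give the axes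
   orthogonal to its frequencies. The bound k <= d - 1 makes j positive. *)
have [j j0 dE] : exists2 j, (0 < j)%N & d = (j.+1 + k')%N.
  by exists (d - k'.+1)%N; lia.
subst d; rewrite (_ : (j.+1 + k' - k'.+1)%N = j); last by lia.
exact: cap_eigenfunction_estimates.
Qed.
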